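(* Let $\mathbb K$ be a non-discrete non-Archimedean local field and let $(\mathbf L,\mathbf c)$ be any Brascamp--Lieb datum over $\mathbb K$, with $\mathbf L=(L_j)_{1\le j\le m}$, $L_j:\mathbb K^n\to\mathbb K^{n_j}$ linear, such that $\bigcap_{j=1}^m\ker L_j=\{0\}$. Then $\operatorname{BL}(\mathbf L,\mathbf c)<+\infty$ if and only if there is some tuple $\mathbf f=(f_j)_{1\le j\le m}$ of nonnegative nonzero Schwartz--Bruhat functions $f_j:\mathbb K^{n_j}\to\mathbb R_{\ge0}$ such that $\operatorname{BL}(\mathbf L,\mathbf c)=\operatorname{BL}(\mathbf L,\mathbf c;\mathbf f)$. Moreover, in this case, there is an invertible $n\times n$ matrix $A$ over $\mathbb K$ such that the extremizer $f_j$ may be taken to be $1_{(L_j\circ A)(\mathcal O_n)}$.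
   Context: $\mathbb K$ is a non-discrete non-Archimedean local field (a finite extension of $\mathbb Q_p$, or $\mathbb F_{q}((t))$ with $q$ a prime power), $|\cdot|$ is its absolute value given by the modular function of Haar measure, and $\mathcal O_1=\{x\in\mathbb K:|x|\le1\}$. $\mathbb K^k$ carries the max norm, $\mathcal O_k=\mathcal O_1^k$, and all integrals are against Haar measure $\mu_k$ on $\mathbb K^k$ normalized by $\mu_k(\mathcal O_k)=1$. A function $\mathbb K^k\to\mathbb C$ is Schwartz--Bruhat if it is compactly supported and locally constant; equivalently, there are $h,\gamma\in\mathbb K^\times$ such that it is supported in $\gamma\mathcal O_k$ and invariant under translation by $h\mathcal O_k$. $1_E$ denotes the indicator function of $E$. A Brascamp--Lieb datum is a pair $(\mathbf L,\mathbf c)$ with $\mathbf L=(L_j)_{1\le j\le m}$ a tuple of $\mathbb K$-linear maps $L_j:\mathbb K^n\to\mathbb K^{n_j}$ and $\mathbf c=(c_j)_{1\le j\le m}\in[0,1]^m$. For a tuple $\mathbf f=(f_j)_{1\le j\le m}$ of nonnegative nonzero Schwartz--Bruhat functions, $f_j$ defined on $\mathbb K^{n_j}$, $$\operatorname{BL}(\mathbf L,\mathbf c;\mathbf f)=\frac{\int_{\mathbb K^n}\prod_{j=1}^m f_j^{c_j}\circ L_j}{\prod_{j=1}^m\big(\int_{\mathbb K^{n_j}}f_j\big)^{c_j}},$$ and $\operatorname{BL}(\mathbf L,\mathbf c)\in[0,+\infty]$ is the supremum of $\operatorname{BL}(\mathbf L,\mathbf c;\mathbf f)$ over all such tuples $\mathbf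 f$. Indices with $c_j=0$ may be omitted without changing these quantities.
   Formalization: The kernels are intersected only over j with c_j ≠ 0 (otherwise BL is infinite yet attained), and the indicator of (L_j∘A)(O_n) is claimed to be Schwartz–Bruhat only when c_j ≠ 0 or L_j is surjective (otherwise it is not locally constant). *)

(* Defs.v *)
From HB Require Import structures.
From mathcomp Require Import all_boot all_order all_algebra.
From mathcomp Require Import all_classical all_reals all_analysis.

Set Implicit Arguments.
Unset Strict Implicit.
Unset Printing Implicit Defensive.

Import Order.TTheory GRing.Theory Num.Theory.
Local Open Scope classical_set_scope.
Local Open Scope ring_scope.

HB.mixin Record isNonArchValued (R : realType) K & GRing.Field K := {
  absv : K -> R ;
  absv_ge0 : forall x, 0 <= absv x ;
  absv_eq0 : forall x, absv x = 0 <-> x = 0 ;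
  absvM : forall x y, absv (x * y) = absv x * absv y ;
  absvD_max : forall x y, absv (x + y) <= Num.max (absv x) (absv y)
}.

#[short(type="nonArchFieldType")]
HB.structure Definition NonArchField (R : realType) :=
  {K of GRing.Field K & isNonArchValued R K}.

(* [mtop K] is [K] with the metric [absv (x - y)].  It is an alias because
   Hierarchy Builder refuses a common structure for [GRing.Field] and
   [PseudoMetric] lying outside the numeric normed hierarchy.  The library puts
   on ['cV[mtop K]_k] the max metric and its (product) topology; this type is
   convertible to ['cV[K]_k], which carries the linear structure. *)
Definition mtop (R : realType) (K : nonArchFieldType R) : Type := K.

Section MetricTopology.
Variables (R : realType) (K : nonArchFieldType R).
Implicit Types x y z : K.

Let dist x y : R := absv (x - y).

Lemma absv1 : absv (1 : K) = 1 :> R.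
Proof.
have a1 : absv (1 : K) != 0 :> R.
  by apply/eqP => /absv_eq0/eqP; rewrite oner_eq0.
by apply: (mulfI a1); rewrite -absvM !mulr1.
Qed.

Lemma absvN x : absv (- x) = absv x :> R.
Proof.
have aN1 : absv (-1 : K) = 1 :> R.
  apply/eqP; rewrite -(@eqrXn2 _ 2) ?absv_ge0 ?ler01//.
  by rewrite !expr2 -absvM mulrNN !mulr1 absv1.
by rewrite -mulN1r absvM aN1 mul1r.
Qed.

Let distxx x : dist x x = 0.
Proof. by rewrite /dist subrr; apply/absv_eq0. Qed.

Let dist_positivity x y : dist x y = 0 -> x = y.
Proof. by move=> /absv_eq0/eqP; rewrite subr_eq0 => /eqP. Qed.

Let dist_sym x y : dist x y = dist y x.
Proof. by rewrite /dist -absvN opprB. Qed.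

Let dist_triangle y x z : dist x z <= dist x y + dist y z.
Proof.
have -> : dist x z = absv ((x - y) + (y - z)) by rewrite addrA subrK.
by rewrite (le_trans (absvD_max _ _))// ge_max lerDl lerDr !absv_ge0.
Qed.

HB.instance Definition _ := Choice.copy (mtop K) K.
HB.instance Definition _ := isPointed.Build (mtop K) (0 : K).
HB.instance Definition _ := @isMetric.Build R (mtop K) dist
  distxx dist_positivity dist_sym dist_triangle.

End MetricTopology.

Notation borel T := (g_sigma_algebraType (@open T)).

(* [op] is the group law of [T].  No regularity is asked for: on the locally
   compact, metrizable, sigma-compact groups considered below, every Borel
   measure finite on compact sets is regular. *)
Definition haar_measure (R : realType) (T : ptopologicalType) (op : T -> T -> T)
    (mu : {measure set (borel T) -> \bar R}) : Prop :=
  [/\ forall C : set T, compact C -> (mu C < +oo)%E,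
      forall U : set T, open U -> U !=set0 -> (0 < mu U)%E &
      forall (a : T) (E : set (borel T)), measurable E ->
        mu [set op a x | x in E] = mu E].

(* [absv_modular] normalizes the absolute value, which the other axioms
   determine only up to a positive power. *)
HB.mixin Record isLocalField (R : realType) K & NonArchField R K := {
  nondiscrete : ~ open [set (0 : K) : mtop K] ;
  locally_compactK : locally_compact [set: mtop K] ;
  absv_modular : forall mu : {measure set (borel (mtop K)) -> \bar R},
    @haar_measure R (mtop K) (+%R : K -> K -> K) mu ->
    forall (a : K) (E : set (borel (mtop K))), a != 0 -> measurable E ->
      mu [set (a * (x : K) : mtop K) | x in E] = ((absv a)%:E * mu E)%E
}.

#[short(type="nonArchLocalFieldType")]
HB.structure Definition NonArchLocalField (R : realType) :=
  {K of NonArchField R K & isLocalField R K}.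

Definition unit_polydisc (R : realType) (K : nonArchFieldType R) (k : nat) :
    set 'cV[K]_k :=
  [set x | forall i, absv (x i 0) <= 1 :> R].
Arguments unit_polydisc {R} K k _.

Section BrascampLieb.
Variables (R : realType) (K : nonArchLocalFieldType R).

Definition normalized_haar (k : nat)
    (mu : {measure set (borel 'cV[mtop K]_k) -> \bar R}) : Prop :=
  @haar_measure R 'cV[mtop K]_k (+%R : 'cV[K]_k -> 'cV[K]_k -> 'cV[K]_k) mu /\
  mu (unit_polydisc K k) = 1%E.

Definition schwartz_bruhat (k : nat) (f : 'cV[mtop K]_k -> R) : Prop :=
  compact (closure [set x | f x != 0]) /\
  forall x, \forall y \near x, f y = f x.

Definition nonneg_nonzero_sb (k : nat) (f : 'cV[K]_k -> R) : Prop :=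
  [/\ schwartz_bruhat f, forall x, 0 <= f x & exists x, f x != 0].

Variable mu : forall k, {measure set (borel 'cV[mtop K]_k) -> \bar R}.
Variables (n m : nat) (d : 'I_m -> nat).
Variables (L : forall j, {linear 'cV[K]_n -> 'cV[K]_(d j)}) (c : 'I_m -> R).

(* [0 `^ 0 = 1], so the indices [j] with [c j = 0] contribute a factor 1 both
   to the integrand and to the denominator. *)
Definition BL_at (f : forall j, 'cV[K]_(d j) -> R) : \bar R :=
  ((\int[mu n]_x (\prod_(j < m) (f j (L j x) `^ c j)%R)%:E) /
   \prod_(j < m) (\int[mu (d j)]_x (f j x)%:E) `^ c j)%E.

Definition BL : \bar R :=
  ereal_sup [set BL_at f | f in [set f | forall j, nonneg_nonzero_sb (f j)]].

End BrascampLieb.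

(* Main.v *)
Require Import Defs.
From HB Require Import structures.
From mathcomp Require Import all_boot all_order all_algebra all_fingroup.
From mathcomp Require Import finmap ring lra zify.
From mathcomp Require Import all_classical all_reals all_analysis.
From mathcomp Require Import measurable_realfun.

Set Implicit Arguments.
Unset Strict Implicit.
Unset Printing Implicit Defensive.

Import Order.TTheory GRing.Theory Num.Theory.
Import numFieldNormedType.Exports.
Local Open Scope classical_set_scope.
Local Open Scope ring_scope.

(** Why the theorem is true. Write [O] for the ring of integers and
    [lattice A] for the image of [O^n] under a matrix [A].

    The supremum is a supremum over lattices. A tuple of Schwartz-Bruhat
    functions lives at some scale: every component is supported in one polydisc
    and invariant under a smaller one. Up to volumes of polydiscs, [BL_at] is
    then the Brascamp-Lieb quotient of a tuple of functions on finite abelian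
    groups. There it is settled by convolution: Ball's inequality
    ([multiform_convol]) says that the convolution of two maximizers is a
    maximizer, while convolution lowers the l2 norm unless the functions are
    flat and supported on cosets. A maximizer of least l2 norm therefore yields
    subgroups, stable under every automorphism compatible with the data
    ([finite_brascamp_lieb]). Multiplications by units of [O] are such
    automorphisms, and units generate [O] additively, so the subgroups lift to
    [O]-modules ([BL_at_le_modules]). An [O]-module that is compact and open is
    [lattice A] for some invertible [A], by Cramer's rule applied to a basis
    with determinant of maximal absolute value ([lattice_basis]). Hence the
    supremum is that of [lattice_ratio A], the volume of [lattice A] divided by
    the product of the volumes of its images to the powers [c j].

    The supremum over lattices is attained ([exists_best_lattice]). The values
    of [lattice_ratio] may be dense when some [c j] is irrational, so
    discreteness is of no direct use. Decompose [A = P D Q] with [D] diagonal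
    and [P], [Q] isometries ([smith]); the factor [Q] does not change the
    lattice. The volume of the image lattice is governed by a maximal minor of
    [M j P D], where [M j] is the matrix of [L j]. If [P] is close to [P0], a
    minor that is maximal for [M j P0 D] keeps its size in [M j P D], whatever
    [D] is, so that [lattice_ratio (P D) <= lattice_ratio (P0 D)]
    ([dominated_near]); by compactness only finitely many [P] matter. For fixed
    [P], suppose that the ratio increases strictly along diagonal matrices
    [D_0], [D_1] and so on. Dickson's lemma provides [i < i'] such that the same
    minors are maximal for [D_i] and [D_i'] and dominate the other minors by at
    least as much for [D_i']. Then they stay maximal for [D_i V^t] with
    [V = D_i' / D_i] and every [t], and the ratio grows geometrically in [t],
    which contradicts the finiteness of [BL] ([exists_best_diag]).

    Finally, when [BL] is finite, [L j] is onto for [c j != 0]: otherwise thin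
    neighbourhoods of its image make the quotient arbitrarily large
    ([BL_fin_row_free]). *)

(** * Elementary facts *)

Lemma finite_lower_bound (R : realType) (I : finType) (e : I -> R) :
  (forall i, 0 < e i) -> exists2 e0, 0 < e0 & forall i, e0 <= e i.
Proof.
move=> e0; have S0 : 0 <= \sum_i (e i)^-1.
  by apply: sumr_ge0 => i _; rewrite invr_ge0 ltW.
exists (1 + \sum_i (e i)^-1)^-1 => [|i]; first by rewrite invr_gt0 ltr_pwDl.
rewrite -[leRHS]invrK lef_pV2 ?posrE ?invr_gt0 ?ltr_pwDl//.
rewrite (bigD1 i)//= addrCA lerDl addr_ge0// sumr_ge0// => k _.
by rewrite invr_ge0 ltW.
Qed.

Lemma finite_upper_bound (R : realType) (I : finType) (r : I -> R) :
  exists2 r0, 1 <= r0 & forall i, r i <= r0.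
Proof.
have S0 (P : pred I) : 0 <= \sum_(i | P i) `|r i| by exact: sumr_ge0.
exists (1 + \sum_i `|r i|) => [|i]; first by rewrite lerDl.
rewrite (le_trans (ler_norm _))// (bigD1 i)//= addrCA lerDl.
by rewrite addr_ge0.
Qed.

Lemma expr_lt_eventually (R : realType) (p x : R) : 0 < p < 1 -> 0 < x ->
  exists N, p ^+ N < x.
Proof.
move=> /andP[p0 p1] x0.
have /cvgrPdist_lt /(_ _ x0) [N _ /(_ N (leqnn N))] : (p ^+ n @[n --> \oo] --> (0 : R)).
  by apply: cvg_expr; rewrite ger0_norm// ltW.
by rewrite /= sub0r normrN ger0_norm ?exprn_ge0 ?(ltW p0)//; exists N.
Qed.

Lemma powR_expr (R : realType) (a c : R) N : 0 <= a -> (a ^+ N) `^ c = (a `^ c) ^+ N.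
Proof.
by move=> a0; rewrite -powR_mulrn// powRAC powR_mulrn// powR_ge0.
Qed.

Lemma exists_additive (U V : zmodType) (f : U -> V) : zmod_morphism f ->
  exists g : {additive U -> V}, forall x, g x = f x.
Proof.
move=> fB; pose m := GRing.isZmodMorphism.Build U V f fB.
by pose g : {additive U -> V} := HB.pack f m; exists g.
Qed.

(** * The inequality on finite abelian groups *)

Lemma continuous_norm_powR (R : realType) (c : R) : 0 <= c ->
  continuous (fun x : R => `|x| `^ c).
Proof.
rewrite le_eqVlt => /predU1P[<-|c0] x.
  under eq_fun do rewrite powRr0.
  exact: cvg_cst.
have [->|x0] := eqVneq x 0.
  rewrite /continuous_at normr0 powR0 ?gt_eqF//.
  apply/cvgr0Pnorm_lt => e e0.
  exists (e `^ c^-1); first by rewrite /= powR_gt0.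
  move=> y /=; rewrite sub0r normrN => ye.
  rewrite ger0_norm ?powR_ge0//.
  rewrite -[ltRHS]powRr1 ?ltW// -(mulVf (lt0r_neq0 c0)) powRrM.
  by apply: gt0_ltr_powR => //; rewrite nnegrE ?powR_ge0.
apply: (@continuous_comp _ _ _ (fun x : R => `|x|) (fun y => y `^ c)).
  exact: norm_continuous.
apply: differentiable_continuous; apply/derivable1_diffP.
by apply: derivable_powR; rewrite in_itv/= andbT normr_gt0.
Qed.

Section FiniteBL.
Variables (R : realType) (m : nat) (G : finZmodType) (H : 'I_m -> finZmodType).
Variables (phi : forall j, {additive G -> H j}) (c : 'I_m -> R).
Hypothesis c0 : forall j, 0 <= c j.

Local Notation idx := {j : 'I_m & H j}.
Local Notation fam := (prod_topology (fun _ : idx => (R : topologicalType))).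
Local Notation at_ f j y := (f (Tagged H (i:=j) y)).

(** A family of functions, one on each [H j], is coded as a single function on
    the disjoint union of the [H j]: such functions form a product of copies of
    [R], to which Tychonoff's theorem applies. The absolute value makes the
    form continuous at families with negative entries too. *)
Definition multiform (f : idx -> R) : R :=
  \sum_(x : G) \prod_(j < m) `|at_ f j (phi j x)| `^ c j.
Definition mass (f : idx -> R) j : R := \sum_(y : H j) at_ f j y.
Definition distr : set (idx -> R) :=
  [set f | (forall i, 0 <= f i) /\ forall j, mass f j = 1].
Definition energy (f : idx -> R) : R :=
  \sum_(j < m) \sum_(y : H j) at_ f j y ^+ 2.
Definition convol (f g : idx -> R) : idx -> R :=
  fun i => \sum_(w : H (tag i)) at_ f (tag i) w * at_ g (tag i) (tagged i - w).

Let eval_cont (i : idx) : continuous (fun f : fam => f i).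
Proof. exact: (@proj_continuous _ (fun=> (R : topologicalType)) i). Qed.

Let sum_cont (T : topologicalType) (I : Type) (r : seq I) (F : I -> T -> R) :
  (forall i, continuous (F i)) -> continuous (fun x => \sum_(i <- r) F i x).
Proof.
move=> cF; elim: r => [|i r IH] x.
  by under eq_fun do rewrite big_nil; exact: cvg_cst.
by under eq_fun do rewrite big_cons; apply: cvgD; [exact: cF|exact: IH].
Qed.

Let prod_cont (T : topologicalType) (I : Type) (r : seq I) (F : I -> T -> R) :
  (forall i, continuous (F i)) -> continuous (fun x => \prod_(i <- r) F i x).
Proof.
move=> cF; elim: r => [|i r IH] x.
  by under eq_fun do rewrite big_nil; exact: cvg_cst.
by under eq_fun do rewrite big_cons; apply: cvgM; [exact: cF|exact: IH].
Qed.

Let multiform_cont : continuous (multiform : fam -> R).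
Proof.
apply: sum_cont => x; apply: prod_cont => j f.
apply: (@continuous_comp _ _ _ (fun f : fam => at_ f j (phi j x))
   (fun y => `|y| `^ c j)); first exact: eval_cont.
exact: continuous_norm_powR.
Qed.

Let energy_cont : continuous (energy : fam -> R).
Proof.
apply: sum_cont => j; apply: sum_cont => y f.
apply: (@continuous_comp _ _ _ (fun f : fam => at_ f j y) (fun y => y ^+ 2)).
  exact: eval_cont.
exact: exprn_continuous.
Qed.

Let distr_compact : compact (distr : set fam).
Proof.
apply: (@subclosed_compact _ _ [set f : fam | forall i, `[0, 1]%classic (f i)]).
- have -> : (distr : set fam) =
    \bigcap_i ((fun f : fam => f i) @^-1` [set x | 0 <= x]) `&`
    \bigcap_j ((mass^~ j : fam -> R) @^-1` [set 1]).
    apply/seteqP; split=> f [f0 f1]; split=> i.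
    - by move=> _; exact: f0.
    - by move=> _; exact: f1.
    - exact: f0.
    - exact: f1.
  apply: closedI; apply: closed_bigI => i _; apply: closed_comp.
  + by move=> f _; exact: eval_cont.
  + exact: closed_ge.
  + by move=> f _; apply: sum_cont => y; exact: eval_cont.
  + exact: closed_eq.
- by apply: (@tychonoff _ (fun=> R : topologicalType) (fun=> `[0, 1]%classic)) => i; exact: segment_compact.
- move=> f [f0 f1] [j y] /=; rewrite in_itv/= f0/= -(f1 j) /mass.
  by rewrite (bigD1 y)//= lerDl sumr_ge0.
Qed.

Let uniform : idx -> R := fun i => (#|H (tag i)|%:R)^-1.

Let carrier_gt0 j : 0 < #|H j|%:R :> R.
Proof. by rewrite ltr0n; apply/card_gt0P; exists 0. Qed.

Let uniform_distr : distr uniform.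
Proof.
split=> [i|j]; first by rewrite invr_ge0 ltW.
rewrite /mass /uniform /= sumr_const -[LHS]mulr_natr mulVf// gt_eqF//; exact: carrier_gt0.
Qed.

Let multiform_uniform : 0 < multiform uniform.
Proof.
rewrite /multiform (bigD1 0)//= ltr_pwDl ?sumr_ge0//.
  by apply: prodr_gt0 => j _; rewrite powR_gt0// normr_gt0 invr_eq0 gt_eqF.
by move=> x _; apply: prodr_ge0 => j _; exact: powR_ge0.
Qed.

Definition maximizer f := distr f /\ forall g, distr g -> multiform g <= multiform f.

(** Convolution does not increase the energy, and preserves it only for
    functions that are flat on their support; this is what selects indicator
    functions among the maximizers. *)
Definition tight f := maximizer f /\ forall g, maximizer g -> energy f <= energy g.

Lemma exists_tight : exists f, tight f.
Proof.
have [f /set_mem fd fmax] : exists2 f : fam, f \in distr &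
    forall g : fam, g \in distr -> multiform g <= multiform f.
  apply: compact_EVT_max => //; first by exists uniform.
  by apply: continuous_subspaceT => g; exact: multiform_cont.
pose X : set fam := distr `&` (multiform : fam -> R) @^-1` [set multiform f].
have [g] : exists2 g : fam, g \in X & forall g', g' \in X -> energy g <= energy g'.
  apply: compact_EVT_min.
  - by exists f.
  - apply: compact_closedI => //; apply: closed_comp; last exact: closed_eq.
    by move=> ? _; exact: multiform_cont.
  - by apply: continuous_subspaceT => ?; exact: energy_cont.
move=> /set_mem [gd /= gf] gmin; exists g; split.
  by split=> // h hd; rewrite gf fmax//; exact/mem_set.
move=> h [hd hmax]; apply: gmin; apply/mem_set; split=> //=.
by apply/eqP; rewrite eq_le hmax// fmax//; exact/mem_set.
Qed.

Let sum_shift j (F : H j -> R) w : \sum_u F (u - w) = \sum_u F u.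
Proof.
rewrite (reindex_inj (addIr w)).
by apply: eq_bigr => u _; rewrite addrK.
Qed.

Let sum_reflect j (F : H j -> R) u : \sum_w F (u - w) = \sum_w F w.
Proof.
rewrite (reindex_inj (inj_comp (addrI u) oppr_inj)).
by apply: eq_bigr => w _ /=; rewrite opprD opprK addrA subrr add0r.
Qed.

Lemma convol_ge0 f g : (forall i, 0 <= f i) -> (forall i, 0 <= g i) ->
  forall i, 0 <= convol f g i.
Proof. by move=> f0 g0 i; apply: sumr_ge0 => w _; rewrite mulr_ge0. Qed.

Lemma convol_distr f g : distr f -> distr g -> distr (convol f g).
Proof.
move=> [f0 f1] [g0 g1]; split=> [|j]; first exact: convol_ge0.
rewrite /mass /convol /= exchange_big/= -(f1 j); apply: eq_bigr => w _.
by rewrite -mulr_sumr (sum_shift (fun u => at_ g j u)) [X in _ * X]g1 mulr1.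
Qed.

(** Homogeneity: divide every component by its mass. A component of mass zero
    vanishes and is replaced by the uniform distribution: the factors on both
    sides are then 0, or 1 if [c j = 0]. *)
Lemma multiform_le_mass f g : (forall i, 0 <= f i) -> maximizer g ->
  multiform f <= multiform g * \prod_(j < m) mass f j `^ c j.
Proof.
move=> f0 [gd gmax].
have mf0 j : 0 <= mass f j by apply: sumr_ge0.
pose f' i := if mass f (tag i) == 0 then uniform i else f i / mass f (tag i).
have f'd : distr f'.
  split=> [i|j].
    rewrite /f'; case: ifP => _; first by case: uniform_distr.
    by rewrite divr_ge0.
  have [mf|mf] := eqVneq (mass f j) 0; rewrite /mass.
    under eq_bigr do rewrite /f' /= mf eqxx; exact: (proj2 uniform_distr).
  by under eq_bigr do rewrite /f' /= (negbTE mf); rewrite -mulr_suml divff.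
apply: (le_trans (y := multiform f' * \prod_(j < m) mass f j `^ c j)); last first.
  by rewrite ler_wpM2r ?gmax// prodr_ge0// => j _; exact: powR_ge0.
rewrite mulr_suml; apply: ler_sum => x _; rewrite -big_split/=.
apply: ler_prod => j _; rewrite powR_ge0/= /f' /=.
have [mf|mf] := eqVneq (mass f j) 0.
  have -> : at_ f j (phi j x) = 0.
    by move/eqP: mf; rewrite psumr_eq0// => /allP/(_ (phi j x)); rewrite mem_index_enum => /(_ isT)/eqP.
  rewrite mf normr0; have [->|cj] := eqVneq (c j) 0; first by rewrite !powRr0 mulr1.
  by rewrite powR0// mulr0.
rewrite -powRM// normrM normfV (ger0_norm (mf0 j)) divfK//.
Qed.

(** Ball's inequality. Expand the product as a sum over [x] and [y = u - x].
    For fixed [u], the sum over [x] is the form of the family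
    [w |-> f w * g (phi u - w)], and its masses are the values of
    [convol f g] at the [phi j u]. *)
Lemma multiform_convol f g e : (forall i, 0 <= f i) -> (forall i, 0 <= g i) ->
  maximizer e -> multiform f * multiform g <= multiform e * multiform (convol f g).
Proof.
move=> f0 g0 emax.
have -> : multiform f * multiform g = \sum_(u : G)
    multiform (fun i => f i * at_ g (tag i) (phi (tag i) u - tagged i)).
  rewrite /multiform mulr_suml exchange_big/=; apply: eq_bigr => x _.
  rewrite (reindex_inj (addIr (- x)))/= mulr_sumr; apply: eq_bigr => u _.
  rewrite -big_split/=; apply: eq_bigr => j _.
  by rewrite -powRM// -normrM raddfB.
rewrite [X in _ <= _ * X]/multiform mulr_sumr; apply: ler_sum => u _.
apply: le_trans (multiform_le_mass _ emax) _ => [i|]; first by rewrite mulr_ge0.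
rewrite ler_wpM2l ?sumr_ge0// => [x _|].
  by rewrite prodr_ge0// => j _; rewrite powR_ge0.
apply: ler_prod => j _; rewrite powR_ge0/= ger0_norm//; exact: convol_ge0.
Qed.

(** Since [2 a b <= a ^ 2 + b ^ 2], every value of [convol f g] on [H j] is at
    most the mean [s j] of the energies of [f] and [g] there. The total mass is
    1, so the energy of [convol f g] is at most that of [f]. As [convol f g] is
    a maximizer, minimality turns all these estimates into equalities. *)
Lemma tight_convol f g : tight f -> tight g ->
  tight (convol f g) /\
  forall j u, at_ (convol f g) j u != 0 -> forall w, at_ f j w = at_ g j (u - w).
Proof.
move=> [fM fE] [gM gE]; have [[fd fmax] [gd gmax]] := (fM, gM).
have [[f0 f1] [g0 g1]] := (fd, gd).
set h := convol f g; have hd : distr h by exact: convol_distr.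
have [h0 h1] := hd.
have Mfg : multiform f = multiform g by apply/eqP; rewrite eq_le fmax ?gmax.
have Mf0 : 0 < multiform f by rewrite (lt_le_trans multiform_uniform)// fmax.
have hM : maximizer h.
  split=> // k kd; apply: le_trans (fmax _ kd) _.
  by rewrite -(ler_pM2l Mf0) {2}Mfg multiform_convol.
have Efg : energy f = energy g by apply/eqP; rewrite eq_le fE ?gE.
pose sq (k : idx -> R) j := \sum_y at_ k j y ^+ 2.
pose s j := (sq f j + sq g j) / 2.
have gap j u : s j - at_ h j u = (\sum_w (at_ f j w - at_ g j (u - w)) ^+ 2) / 2.
  under eq_bigr do rewrite sqrrB.
  rewrite big_split/= sumrB sumrMnl (sum_reflect (fun w => at_ g j w ^+ 2)).
  by rewrite /s /sq /h /convol /=; field.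
have hs j u : at_ h j u <= s j.
  by rewrite -subr_ge0 gap divr_ge0// sumr_ge0// => w _; exact: sqr_ge0.
have Es : energy f = \sum_j s j.
  rewrite /s -mulr_suml big_split/= -[X in X + _]/(energy f) -[X in _ + X]/(energy g).
  by rewrite -Efg; field.
have Eh : energy f - energy h = \sum_j \sum_y at_ h j y * (s j - at_ h j y).
  rewrite Es /energy -sumrB; apply: eq_bigr => j _.
  under [in RHS]eq_bigr do rewrite mulrBr -expr2.
  by rewrite sumrB -mulr_suml [X in X * _]h1 mul1r.
have pos j y : 0 <= at_ h j y * (s j - at_ h j y) by rewrite mulr_ge0// subr_ge0.
have Ehf : energy h <= energy f.
  by rewrite -subr_ge0 Eh; apply: sumr_ge0 => j _; apply: sumr_ge0.
split; first by split=> // k kM; apply: le_trans Ehf (fE _ kM).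
move=> j u hu0 w; have : energy f - energy h == 0 by rewrite subr_eq0 eq_le fE.
rewrite Eh psumr_eq0 => [|i _]; last exact: sumr_ge0.
move=> /allP/(_ j); rewrite mem_index_enum => /(_ isT).
rewrite psumr_eq0// => /allP/(_ u); rewrite mem_index_enum => /(_ isT).
rewrite /= mulf_eq0 (negbTE hu0)/= gap mulf_eq0 invr_eq0 pnatr_eq0 orbF.
rewrite psumr_eq0 => [|i _]; last exact: sqr_ge0.
move=> /allP/(_ w); rewrite mem_index_enum => /(_ isT).
by rewrite /= sqrf_eq0 subr_eq0 => /eqP.
Qed.

Lemma tight_precomp f (a : G -> G) (psi : forall j, H j -> H j) :
  injective a -> (forall j, injective (psi j)) ->
  (forall j x, phi j (a x) = psi j (phi j x)) ->
  tight f -> tight (fun i => at_ f (tag i) (psi (tag i) (tagged i))).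
Proof.
move=> ainj psiinj compat [[[f0 f1] fmax] fE]; set g := (fun i => _).
have Mg : multiform g = multiform f.
  rewrite /multiform [RHS](reindex_inj ainj); apply: eq_bigr => x _.
  by apply: eq_bigr => j _; rewrite compat.
split; first split.
- split=> [i|j]; first exact: f0.
  by rewrite -(f1 j) /mass [RHS](reindex_inj (psiinj j)).
- by rewrite Mg.
- move=> h /fE; apply: le_trans; rewrite le_eqVlt; apply/orP; left; apply/eqP.
  rewrite /energy; apply: eq_bigr => j _.
  by rewrite [RHS](reindex_inj (psiinj j)).
Qed.

Definition compatible (a : G -> G) (psi : forall j, {additive H j -> H j}) :=
  [/\ injective a, (forall j, injective (psi j)) &
      forall j x, phi j (a x) = psi j (phi j x)].

(** Convolving a tight family with its reflection gives a tight family [h] with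
    [h 0 != 0] on each [H j]. By [tight_convol] applied to [h] and its
    composition with [- psi], one has [h z = h (- psi (v - z))] for all [z] as
    soon as [h (- psi v) != 0]. For [psi] the identity this says that [h] is
    invariant under translation by its support, which is thus a subgroup on
    which [h] is constant; for [v = 0] it says that the support is stable under
    [psi]. *)
Theorem finite_brascamp_lieb : exists T : forall j, {set H j},
  [/\ forall j, 0 \in T j,
      forall j, {in T j &, forall x y, x + y \in T j},
      forall a psi, compatible a psi ->
        forall j, {in T j, forall x, psi j x \in T j} &
      forall f : idx -> R, (forall i, 0 <= f i) ->
        multiform f <=
        #|[set x | [forall j, (c j != 0) ==> (phi j x \in T j)]]%SET|%:R /
        \prod_(j < m) #|T j|%:R `^ c j * \prod_(j < m) mass f j `^ c j].
Proof.
have [f ft] := exists_tight.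
pose rf : idx -> R := fun i => at_ f (tag i) (- tagged i).
have rft : tight rf.
  apply: (@tight_precomp f -%R (fun j => -%R)) => //; try by move=> *; exact: oppr_inj.
  by move=> j x; rewrite raddfN.
have [ht _] := tight_convol ft rft; set h := convol f rf in ht.
have [[[h0 h1] hmax] _] := ht.
have hz j : at_ h j 0 != 0.
  apply/eqP => /eqP; rewrite psumr_eq0 => [/allP fz|w _]; last first.
    by rewrite mulr_ge0//; [case: ft => -[[]]|case: rft => -[[]]].
  have [[[_ f1] _] _] := ft; have := f1 j; rewrite /mass big1 => [/eqP|w _].
    by rewrite eq_sym oner_eq0.
  by have := fz w; rewrite mem_index_enum => /(_ isT); rewrite /rf /= sub0r opprK mulf_eq0 orbb => /eqP.
have key (a : G -> G) (psi : forall j, {additive H j -> H j}) j v : compatible a psi ->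
    at_ h j (- psi j v) != 0 -> forall z, at_ h j z = at_ h j (- psi j (v - z)).
  move=> [ainj psiinj compat] hv z.
  pose g : idx -> R := fun i => at_ h (tag i) (- psi (tag i) (tagged i)).
  have gt : tight g.
    apply: (@tight_precomp h (fun x => - a x) (fun j y => - psi j y)) => //.
    - by move=> x y /oppr_inj/ainj.
    - by move=> k x y /oppr_inj/psiinj.
    - by move=> k x; rewrite raddfN compat.
  have [_ /(_ j v)] := tight_convol ht gt; apply.
  rewrite gt_eqF// /convol /= (bigD1 0)//= subr0 ltr_pwDl//.
    by rewrite mulr_gt0// lt_neqAle eq_sym ?hz ?hv ?h0.
  by apply: sumr_ge0 => w _; apply: mulr_ge0; exact: h0.
have compat1 : compatible id (fun j => idfun : {additive H j -> H j}).
  by split=> [x y|j x y|j x].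
have hshift j t z : at_ h j t != 0 -> at_ h j z = at_ h j (z + t).
  move=> ht0; have := @key _ _ j (- t) compat1; rewrite /= opprK => /(_ ht0) ->.
  by rewrite opprD !opprK addrC.
pose T j := [set y | at_ h j y != 0]%SET; exists T; split.
- by move=> j; rewrite inE.
- by move=> j x y; rewrite !inE => hx hy; rewrite -hshift.
- move=> a psi compat j x; rewrite !inE => hx.
  rewrite (@key a psi j 0 compat) ?raddf0 ?oppr0//  in hx.
  by rewrite sub0r raddfN opprK in hx.
move=> g g0; apply: le_trans (multiform_le_mass g0 (proj1 ht)) _.
rewrite ler_wpM2r ?prodr_ge0// => [j _|]; first exact: powR_ge0.
have hT j y : at_ h j y = (y \in T j)%:R * at_ h j 0.
  rewrite inE; have [->|hy] := eqVneq; first by rewrite mul0r.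
  by rewrite mul1r (hshift j y 0)// add0r.
have hV j : at_ h j 0 = (#|T j|%:R)^-1.
  apply: (mulfI (_ : #|T j|%:R != 0)).
    by rewrite pnatr_eq0 -lt0n; apply/card_gt0P; exists 0; rewrite inE.
  rewrite divff; last first.
    by rewrite pnatr_eq0 -lt0n; apply/card_gt0P; exists 0; rewrite inE.
  rewrite -[RHS](h1 j) /mass; under [RHS]eq_bigr do rewrite hT.
  rewrite -mulr_suml -natr_sum; congr (_%:R * _).
  by rewrite -sum1_card big_mkcond; apply: eq_bigr => y _; case: (y \in T j).
rewrite /multiform -sum1_card natr_sum mulr_suml [leRHS]big_mkcond/=.
apply: ler_sum => x _; rewrite inE mul1r.
case: ifPn => [/forallP Tx|/forallPn[j]]; last first.
  rewrite negb_imply => /andP[cj xT].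
  by rewrite (bigD1 j)//= hT (negbTE xT) mul0r normr0 powR0// mul0r.
rewrite -prodfV; apply: ler_prod => j _; rewrite powR_ge0/=.
have := Tx j; have [->|cj /= xT] := eqVneq (c j) 0; first by rewrite !powRr0 invr1.
by rewrite hT xT mul1r hV ger0_norm ?invr_ge0// -powR_inv1// -powRrM mulN1r powRN.
Qed.

End FiniteBL.

(** * Finite quotients of abelian groups *)

Section FiniteQuotient.
Variables (V : zmodType) (A B : set V) (s : seq V).
Hypotheses (A0 : A 0) (AB : forall x y, A x -> A y -> A (x - y)).
Hypotheses (B0 : B 0) (BB : forall x y, B x -> B y -> B (x - y)).
Hypotheses (BA : B `<=` A) (sA : forall x, A x -> exists2 y, y \in s & B (x - y)).

Let AN x : A x -> A (- x).
Proof. by move=> Ax; rewrite -sub0r; exact: AB. Qed.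
Let AD x y : A x -> A y -> A (x + y).
Proof. by move=> Ax Ay; rewrite -[y]opprK; apply: AB => //; exact: AN. Qed.
Let BN x : B x -> B (- x).
Proof. by move=> Bx; rewrite -sub0r; exact: BB. Qed.
Let BD x y : B x -> B y -> B (x + y).
Proof. by move=> Bx By; rewrite -[y]opprK; apply: BB => //; exact: BN. Qed.

Let t := [seq y <- s | `[< A y >]].
(** The first listed element of the coset of [x], so that the quotient can be
    realized as a finite list of elements of [V]. *)
Let canon x := nth 0 t (find (fun y => `[< B (x - y) >]) t).

Let canonP x : A x -> canon x \in t /\ B (x - canon x).
Proof.
move=> Ax; have hasx : has (fun y => `[< B (x - y) >]) t.
  have [y ys Bxy] := sA Ax; apply/hasP; exists y; last exact/asboolP.
  rewrite mem_filter ys andbT; apply/asboolP.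
  by rewrite -[y](subKr x); apply: AB => //; exact: BA.
split; first by rewrite mem_nth -?has_find.
by have /asboolP := nth_find 0 hasx.
Qed.

Let canon_eq x y : B (x - y) -> canon x = canon y.
Proof.
move=> Bxy; congr nth; apply: eq_find => z.
apply/asboolP/asboolP => Bz.
  by rewrite -[y](subKr x) addrAC; apply: BB.
by rewrite -[x](subrK y) -addrA; apply: BD.
Qed.

Let u := [seq y <- t | canon y == y].

Let canon_u x : A x -> canon x \in u.
Proof.
move=> Ax; have [xt Bx] := canonP Ax.
rewrite mem_filter xt andbT; apply/eqP; apply: canon_eq.
by rewrite -opprB; exact: BN.
Qed.

Definition finite_quotient : Type := seq_sub u.
HB.instance Definition _ := Finite.on finite_quotient.

Let proj x : finite_quotient := insubd (SeqSub (canon_u A0)) (canon x).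

Let rep (q : finite_quotient) : V := ssval q.

Let valA (q : finite_quotient) : A (rep q).
Proof. by have := ssvalP q; rewrite !mem_filter => /and3P[_ /asboolP]. Qed.

Let val_proj x : A x -> rep (proj x) = canon x.
Proof. by move=> Ax; apply: (insubdK _ (canon_u Ax)). Qed.

Let projK q : proj (rep q) = q.
Proof.
apply: val_inj; rewrite -[LHS]/(rep _) val_proj; last exact: valA.
by have := ssvalP q; rewrite mem_filter => /andP[/eqP].
Qed.

Let proj_sub x : A x -> B (x - rep (proj x)).
Proof. by move=> Ax; rewrite val_proj//; case: (canonP Ax). Qed.

Let proj_eq x y : A x -> A y -> B (x - y) -> proj x = proj y.
Proof.
move=> Ax Ay Bxy; apply: val_inj; rewrite -[LHS]/(rep _) -[RHS]/(rep _).
by rewrite !val_proj// (canon_eq Bxy).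
Qed.

Let projD (p q : finite_quotient) := proj (rep p + rep q).
Let projN (p : finite_quotient) := proj (- rep p).

Let projDE x y : A x -> A y -> projD (proj x) (proj y) = proj (x + y).
Proof.
move=> Ax Ay; apply: proj_eq; [by apply: AD; exact: valA|exact: AD|].
rewrite opprD addrACA; apply: BD; rewrite -opprB; apply: BN; exact: proj_sub.
Qed.

Let projDA : associative projD.
Proof.
move=> p q r; rewrite -[p]projK -[q]projK -[r]projK.
by rewrite !projDE ?addrA//; do ?apply: AD; exact: valA.
Qed.

Let projDC : commutative projD.
Proof. by move=> p q; rewrite /projD addrC. Qed.

Let proj0D : left_id (proj 0) projD.
Proof. by move=> p; rewrite -[p]projK projDE ?add0r//; exact: valA. Qed.

Let projND : left_inverse (proj 0) projN projD.
Proof.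
move=> p; have ANp := AN (valA p).
by rewrite -{2}[p]projK projDE ?addNr//; exact: valA.
Qed.

HB.instance Definition _ :=
  GRing.isZmodule.Build finite_quotient projDA projDC proj0D projND.

Lemma exists_finite_quotient :
  exists (Q : finZmodType) (pr : V -> Q) (rep : Q -> V),
  [/\ forall q, A (rep q), cancel rep pr,
      (forall x y, A x -> A y -> pr (x + y) = pr x + pr y) &
      forall x y, A x -> A y -> pr x = pr y <-> B (x - y)].
Proof.
exists finite_quotient, proj, rep; split.
- exact: valA.
- exact: projK.
- by move=> x y Ax Ay; rewrite -[RHS]/(projD _ _) projDE.
- move=> x y Ax Ay; split; last exact: proj_eq.
  move=> xy; have Bx := proj_sub Ax; have := proj_sub Ay; rewrite -xy => By.
  by rewrite -[x](subrK (rep (proj x))) -addrA; apply: BD => //; rewrite -opprB; exact: BN.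
Qed.

End FiniteQuotient.

(** * Polydiscs *)

Section Polydiscs.
Variables (R : realType) (K : nonArchFieldType R).
Implicit Types (k : nat) (r h : R).

Definition polydisc k r : set 'cV[K]_k := [set x | forall i, absv (x i 0) <= r].

Lemma absv_sum (I : Type) (s : seq I) (P : pred I) (F : I -> K) r : 0 <= r ->
  (forall i, P i -> absv (F i) <= r) -> absv (\sum_(i <- s | P i) F i) <= r.
Proof.
move=> r0 Fr; elim/big_ind : _ => [|x y xr yr|//].
  by rewrite (_ : absv 0 = 0)//; apply/absv_eq0.
by rewrite (le_trans (absvD_max _ _))// ge_max xr.
Qed.

Lemma absv0 : absv (0 : K) = 0 :> R.
Proof. exact/absv_eq0. Qed.

Lemma absv_gt0 (x : K) : (0 < absv x :> R) = (x != 0).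
Proof.
by rewrite lt_neqAle absv_ge0 andbT eq_sym; congr (~~ _); apply/eqP/eqP => /absv_eq0.
Qed.

Lemma absvV (x : K) : absv x^-1 = (absv x)^-1 :> R.
Proof.
have [->|x0] := eqVneq x 0; first by rewrite invr0 absv0 invr0.
apply: (mulfI (_ : absv x != 0 :> R)); first by rewrite gt_eqF ?absv_gt0.
by rewrite -absvM !divff ?absv1// gt_eqF ?absv_gt0.
Qed.

Lemma absvX (x : K) n : absv (x ^+ n) = absv x ^+ n :> R.
Proof. by elim: n => [|n IH]; rewrite ?expr0 ?absv1// !exprS absvM IH. Qed.

Lemma absv_prod (I : Type) (s : seq I) (P : pred I) (F : I -> K) :
  absv (\prod_(i <- s | P i) F i) = \prod_(i <- s | P i) absv (F i) :> R.
Proof. by elim/big_rec2 : _ => [|i x y _ <-]; rewrite ?absv1// absvM. Qed.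

Lemma absvB x y r : absv x <= r -> absv y <= r -> absv (x - y : K) <= r.
Proof. by move=> xr yr; rewrite (le_trans (absvD_max _ _))// ge_max absvN xr. Qed.

Lemma polydisc0 k r : 0 <= r -> @polydisc k r 0.
Proof. by move=> r0 i; rewrite mxE absv0. Qed.

Lemma polydiscB k r x y : @polydisc k r x -> polydisc r y -> polydisc r (x - y).
Proof. by move=> xr yr i; rewrite !mxE; exact: absvB. Qed.

Lemma polydiscN k r x : @polydisc k r x -> polydisc r (- x).
Proof. by move=> xr i; rewrite mxE absvN. Qed.

Lemma polydiscD k r x y : @polydisc k r x -> polydisc r y -> polydisc r (x + y).
Proof. by move=> xr yr; rewrite -[y]opprK; apply: polydiscB => //; exact: polydiscN. Qed.

Lemma le_polydisc k r r' : r <= r' -> @polydisc k r `<=` polydisc r'.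
Proof. by move=> rr' x xr i; exact: le_trans (xr i) rr'. Qed.

Lemma polydiscZ k r a x : absv a <= 1 -> @polydisc k r x -> polydisc r (a *: x).
Proof.
by move=> a1 xr i; rewrite mxE absvM (le_trans _ (xr i))// ler_piMl// absv_ge0.
Qed.

Lemma mx_bound k l (A : 'M[K]_(l, k)) : exists2 C : R, 1 <= C & forall i j, absv (A i j) <= C.
Proof.
exists (1 + \sum_i \sum_j absv (A i j)).
  by rewrite lerDl !sumr_ge0// => *; rewrite sumr_ge0// => *; exact: absv_ge0.
move=> i j; rewrite (bigD1 i)//= (bigD1 j)//=.
have := @sumr_ge0 R _ (index_enum _) (fun l => l != i) (fun i => \sum_j absv (A i j)).
move=> /(_ (fun _ _ => sumr_ge0 _ (fun _ _ => absv_ge0 _))).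
have := @sumr_ge0 R _ (index_enum _) (fun l => l != j) (fun j => absv (A i j)).
by move=> /(_ (fun _ _ => absv_ge0 _)); lra.
Qed.

Lemma mx_family_bound (I : finType) (k l : I -> nat) (M : forall i, 'M[K]_(k i, l i)) :
  exists2 C : R, 1 <= C & forall i a b, absv (M i a b) <= C.
Proof.
have /choice[D DP] : forall i, exists C : R, forall a b, absv (M i a b) <= C.
  by move=> i; have [C _ MC] := mx_bound (M i); exists C.
have [C C1 DC] := finite_upper_bound D.
by exists C => // i a b; apply: le_trans (DP i a b) (DC i).
Qed.

Lemma polydisc_mulmx k l r C (A : 'M[K]_(l, k)) x : 0 <= r -> 0 <= C ->
  (forall i j, absv (A i j) <= C) -> @polydisc k r x -> polydisc (C * r) (A *m x).
Proof.
move=> r0 C0 AC xr i; rewrite mxE; apply: absv_sum => [|j _]; first exact: mulr_ge0.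
by rewrite absvM ler_pM// absv_ge0.
Qed.

Lemma ball_mtop (x y : mtop K) (e : R) : ball x e y = (absv (x - y : K) < e) :> Prop.
Proof. by rewrite ballEmdist. Qed.

Lemma nbhs_polydiscP k (x : 'cV[mtop K]_k) (A : set 'cV[mtop K]_k) :
  nbhs x A <-> exists2 r, 0 < r & forall y : 'cV[K]_k, polydisc r (y - x) -> A y.
Proof.
split=> [/nbhs_ballP[e /= e0 eA]|[r r0 rA]].
  exists (e / 2) => [|y ye]; first by rewrite divr_gt0.
  apply: eA; split=> // i j; rewrite ball_mtop ord1 -absvN opprB.
  by have := ye i; rewrite !mxE => /le_lt_trans; apply; lra.
apply/nbhs_ballP; exists r => //= y [_ xy]; apply: rA => i.
by have := xy i 0; rewrite ball_mtop !mxE -absvN opprB => /ltW.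
Qed.

(** Unions of cosets of a polydisc: by the ultrametric inequality they are the
    sets that are uniformly open and closed. *)
Definition periodic k h (E : set 'cV[K]_k) := forall x y, E x -> polydisc h y -> E (x + y).

Lemma periodic_open k h (E : set 'cV[K]_k) : 0 < h -> periodic h E ->
  open (E : set 'cV[mtop K]_k).
Proof.
move=> h0 Eh; rewrite openE => x Ex; apply/nbhs_polydiscP; exists h => // y yx.
by rewrite -[y](subrKC x); exact: Eh.
Qed.

Lemma periodicC k h (E : set 'cV[K]_k) : periodic h E -> periodic h (~` E).
Proof.
move=> Eh x y Ex yh Exy; apply: Ex; rewrite -[x](addrK y); apply: Eh => //.
exact: polydiscN.
Qed.

Lemma periodic_closed k h (E : set 'cV[K]_k) : 0 < h -> periodic h E ->
  closed (E : set 'cV[mtop K]_k).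
Proof.
by move=> h0 Eh; rewrite -[E]setCK; apply: open_closedC; apply: periodic_open (periodicC Eh).
Qed.

Lemma polydisc_periodic k h r : h <= r -> periodic h (@polydisc k r).
Proof. by move=> hr x y xr yh; apply: polydiscD => //; exact: le_polydisc yh. Qed.

Lemma coset_periodic k h a : periodic h [set x | @polydisc k h (x - a)].
Proof. by move=> x y /= xa yh; rewrite addrAC; exact: polydiscD. Qed.

End Polydiscs.

Section LocalField.
Variables (R : realType) (K : nonArchLocalFieldType R).
Implicit Types (k : nat) (r h e : R).

Lemma small_element e : 0 < e -> exists2 x : K, x != 0 & absv x < e.
Proof.
move=> e0; apply: contrapT => noe; apply: (@nondiscrete R K).
rewrite openE => _ ->; apply/nbhs_ballP; exists e => // y.
rewrite ball_mtop sub0r absvN => ye.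
by apply: contrapT => /eqP y0; apply: noe; exists y.
Qed.

Lemma large_element r : exists2 a : K, a != 0 & r <= absv a.
Proof.
have r1 : 0 < (1 + `|r|)^-1 by rewrite invr_gt0 ltr_pwDl.
have [x x0 xe] := small_element r1.
exists x^-1; first by rewrite invr_eq0.
rewrite absvV; apply: (le_trans (y := 1 + `|r|)).
  by rewrite (le_trans (ler_norm _))// lerDr.
by rewrite -[leLHS]invrK lef_pV2 ?posrE ?absv_gt0// ?invr_gt0 ?ltr_pwDl// ltW.
Qed.

Lemma closed_absv_ball r : 0 <= r -> closed ([set x | absv x <= r] : set (mtop K)).
Proof.
move=> r0; rewrite -[X in closed X]setCK; apply: open_closedC.
rewrite openE => x /= /negP; rewrite -ltNge => xr.
apply/nbhs_ballP; exists (absv (x : K)) => /=; first exact: le_lt_trans xr.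
move=> y; rewrite ball_mtop /= => xy; apply/negP; rewrite -ltNge ltNge; apply/negP => yr.
have := absvD_max (x - y : K) y; rewrite subrK le_max => /orP[|] H; lra.
Qed.

(** Some ball around 0 is compact by local compactness, and multiplication by a
    large scalar makes it as large as desired. *)
Lemma compact_absv_ball r : compact ([set x | absv x <= r] : set (mtop K)).
Proof.
have [r0|r0] := ltP r 0.
  rewrite (_ : [set x | _] = set0); first exact: compact0.
  by apply/seteqP; split => x //= xr; have := absv_ge0 x; lra.
have [V] := @locally_compactK R K (0 : K) I.
rewrite /within => /nbhs_ballP[e /= e0 eV] [Vco _].
have [a a0 ar] := large_element (r / (e / 2)).
have cB : compact ([set x | absv x <= e / 2] : set (mtop K)).
  apply: (subclosed_compact _ Vco); first by apply: closed_absv_ball; rewrite divr_ge0// ltW.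
  move=> x /= xe; apply: eV => //.
  by rewrite ball_mtop sub0r absvN; lra.
have cM : continuous (fun x : mtop K => (a * (x : K) : mtop K)).
  move=> x U /nbhs_ballP[d /= d0 dU]; apply/nbhs_ballP.
  exists (d / absv a); first by rewrite /= divr_gt0// absv_gt0.
  move=> y xy; apply: dU; move: xy; rewrite !ball_mtop -mulrBr absvM.
  by rewrite ltr_pdivlMr ?absv_gt0// mulrC.
apply: (subclosed_compact (closed_absv_ball r0)).
  apply: (@continuous_compact _ _ _ _ _ cB).
  by apply: continuous_subspaceT.
move=> x /= xr; exists (a^-1 * x : K); last by rewrite mulrA divff// mul1r.
rewrite /= absvM absvV mulrC ler_pdivrMr ?absv_gt0//.
apply: le_trans xr _; rewrite mulrC -ler_pdivrMr// divr_gt0//.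
Qed.

Lemma compact_polydisc k r : compact (@polydisc R K k r : set 'cV[mtop K]_k).
Proof.
have cr := @rV_compact (mtop K) k (fun=> [set x | absv (x : K) <= r])
  (fun=> compact_absv_ball (r:=r)).
rewrite (_ : (polydisc r : set 'cV[mtop K]_k) =
    @trmx (mtop K) 1 k @` [set v : 'rV[mtop K]_k | forall i, absv (v ord0 i : K) <= r]).
  apply: (@continuous_compact _ _ _ _ _ cr); apply: continuous_subspaceT.
  move=> x U /(@nbhs_polydiscP _ _ k _ U)[d d0 dU]; apply/(@nbhs_ballP R 'rV[mtop K]_k).
  exists d => //= y [_ xy]; apply: dU => i; have := xy 0 i.
  by rewrite ball_mtop !mxE -absvN opprB => /ltW.
apply/seteqP; split=> [x xr|_ [v vr <-] i]; last by rewrite mxE; exact: vr.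
by exists x^T => [i|]; rewrite ?trmxK// mxE; exact: xr.
Qed.

Lemma absv_lipschitz (x y : K) : `|absv x - absv y| <= absv (x - y) :> R.
Proof.
have H (u v : K) : absv u <= absv (u - v) + absv v :> R.
  have := absvD_max (u - v) v; rewrite subrK le_max.
  by have := absv_ge0 v; have := absv_ge0 (u - v) => ? ? /orP[]; lra.
have := H x y; have := H y x; rewrite -(absvN (y - x)) opprB ler_norml => *.
by apply/andP; split; lra.
Qed.

(** The open unit ball is also closed, hence compact, so [absv] attains its
    maximum there: the value group has a gap below 1. *)
Lemma uniformizer : exists2 p : K, 0 < absv p < (1 : R) &
  forall x : K, absv x < (1 : R) -> absv x <= absv p :> R.
Proof.
pose A : set (mtop K) := [set x | absv (x : K) < (1 : R)].
have cA : compact A.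
  apply: (subclosed_compact _ (compact_absv_ball (r:=1))); last by move=> x /= /ltW.
  rewrite -[A]setCK; apply: open_closedC.
  rewrite openE => x /= /negP; rewrite -leNgt => x1.
  apply/nbhs_ballP; exists 1 => //= y; rewrite ball_mtop => xy.
  apply/negP; rewrite -leNgt leNgt; apply/negP => y1.
  have := absvD_max (x - y : K) y; rewrite subrK le_max => /orP[|] H; lra.
have cf : continuous (fun x : mtop K => absv (x : K) : R).
  move=> x U /nbhs_ballP[d /= d0 dU]; apply/nbhs_ballP.
  exists d => //= y; rewrite ball_mtop => xy; apply: dU; apply: le_lt_trans xy; exact: absv_lipschitz.
have [x x0 x1] := small_element ltr01.
have [|p /set_mem pA pmax] := compact_EVT_max _ cA (continuous_subspaceT cf).
  by exists x.
exists p => [|y y1]; last by apply: pmax; exact/mem_set.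
rewrite [absv p < 1]pA andbT; apply: (lt_le_trans (y := absv x)).
  by rewrite absv_gt0.
by apply: pmax; exact/mem_set.
Qed.

Lemma finite_cover k h r : 0 < h -> exists s : seq 'cV[K]_k,
  forall x, polydisc r x -> exists2 y, y \in s & polydisc h (x - y).
Proof.
move=> h0; have := @compact_polydisc k r.
rewrite compact_cover => /(_ 'cV[K]_k setT (fun y => [set x | polydisc h (x - y)])).
case=> [y _|x _|D _ cD].
- by apply: periodic_open h0 _; exact: coset_periodic.
- by exists x => //=; rewrite subrr; exact: polydisc0 (ltW h0).
exists (enum_fset D) => x /cD[y /= yD xy]; by exists y.
Qed.

End LocalField.

(** * Schwartz-Bruhat functions and volumes *)

Section SchwartzBruhat.
Variables (R : realType) (K : nonArchLocalFieldType R).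
Implicit Types (k : nat) (r h e : R).

Definition scaled k h r (f : 'cV[K]_k -> R) :=
  (forall x, f x != 0 -> polydisc r x) /\
  (forall x y, polydisc h y -> f (x + y) = f x).

Lemma compact_bounded k (A : set 'cV[mtop K]_k) : compact A ->
  exists r, A `<=` polydisc r.
Proof.
rewrite compact_cover => /(_ R [set r | 0 < r] (@polydisc R K k)).
case=> [r r0|x _|D D0 cD].
- by apply: periodic_open r0 _; exact: polydisc_periodic.
- have [C C1 xC] := mx_bound (x : 'cV[K]_k); exists C => [|i]; last exact: xC.
  by rewrite /= (lt_le_trans ltr01).
exists (\sum_(r <- enum_fset D) `|r|) => x /cD[r rD]; apply: le_polydisc.
rewrite (big_rem r)//= (le_trans (ler_norm _))// lerDl.
by apply: sumr_ge0.
Qed.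

(** Cover the support by finitely many polydiscs on which [f] is constant and
    let [h] be the smallest radius: by the ultrametric inequality, a polydisc of
    radius [h] that meets the support lies in one of them. *)
Lemma schwartz_bruhat_scaled k (f : 'cV[K]_k -> R) : schwartz_bruhat f ->
  exists h r, 0 < h /\ scaled h r f.
Proof.
move=> [cS fS]; set S := closure _ in cS.
have [r Sr] := compact_bounded cS.
pose near_const x : set R := [set e | 0 < e /\ forall y, polydisc e (y - x) -> f y = f x].
have near_ex x : exists e, near_const x e.
  have /nbhs_polydiscP[e e0 ef] := fS x.
  by exists e; split=> // y /ef.
pose e x := xget 1 (near_const x).
have [e0 ef] : (forall x, 0 < e x) /\ (forall x y, polydisc (e x) (y - x) -> f y = f x).
  by split=> x; have /(_ (near_ex x))[] := @xgetPex _ 1 (near_const x).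
move: (cS); rewrite compact_cover => /(_ 'cV[K]_k setT (fun x => [set y | polydisc (e x) (y - x)])).
case=> [y _|x _|D _ cD].
- by apply: periodic_open (e0 y) _; exact: coset_periodic.
- by exists x => //=; rewrite subrr; exact: polydisc0 (ltW (e0 x)).
have [h h0 hD] : exists2 h, 0 < h & forall x, x \in enum_fset D -> h <= e x.
  elim: (enum_fset D) => [|x s [h h0 hs]]; first by exists 1.
  exists (Num.min h (e x)) => [|y]; first by rewrite lt_min h0 e0.
  rewrite inE => /predU1P[->|/hs hy]; first by rewrite ge_min lexx orbT.
  by rewrite ge_min hy.
have key x y : f x != 0 -> polydisc h y -> f (x + y) = f x.
  move=> fx yh; have /cD[z /= zD xz] : S x by exact: subset_closure.
  rewrite (ef z (x + y)); first by rewrite (ef z).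
  by rewrite addrAC; apply: polydiscD => //; apply: le_polydisc yh; exact: hD.
exists h, r; split=> //; split=> [x fx|x y yh].
  by apply: Sr; exact: subset_closure.
have [fx|fx] := eqVneq (f x) 0; last exact: key.
apply/eqP; rewrite fx; apply/negP => /negP fxy.
have := key (x + y) (- y) fxy (polydiscN yh).
by rewrite addrK fx => f0; rewrite -f0 eqxx in fxy.
Qed.

Lemma scaled_schwartz_bruhat k h r (f : 'cV[K]_k -> R) : 0 < h -> h <= r ->
  scaled h r f -> schwartz_bruhat f.
Proof.
move=> h0 hr [fr fh]; split=> [|x].
  apply: subclosed_compact (@compact_polydisc R K k r) _; first exact: closed_closure.
  rewrite closureE; apply: smallest_sub; last by move=> x /= /fr.
  apply: periodic_closed h0 _; exact: polydisc_periodic.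
apply/nbhs_polydiscP; exists h => // y yx.
by rewrite -[y](subrKC x) fh.
Qed.

Lemma scaled_le k h h' r r' (f : 'cV[K]_k -> R) : h' <= h -> r <= r' ->
  scaled h r f -> scaled h' r' f.
Proof.
move=> hh rr [fr fh]; split=> [x /fr|x y yh]; first exact: le_polydisc.
by apply: fh; exact: le_polydisc yh.
Qed.

Definition compact_open k (E : set 'cV[K]_k) :=
  exists h r, [/\ 0 < h, periodic h E & E `<=` polydisc r].

Lemma scaled_indic k h r (E : set 'cV[K]_k) : periodic h E -> E `<=` polydisc r ->
  scaled h r (\1_E : 'cV[K]_k -> R).
Proof.
move=> Eh Er; split=> [x|x y yh].
  by rewrite indicE; case: (boolP (x \in E)) => [/set_mem/Er//|]; rewrite eqxx.
rewrite !indicE; congr (nat_of_bool _)%:R; apply/idP/idP => /set_mem xE; apply/mem_set.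
  by rewrite -[x](addrK y); apply: Eh => //; exact: polydiscN.
exact: Eh.
Qed.

Lemma image_compact_open k (A : 'M[K]_k) (E : set 'cV[K]_k) : A \in unitmx ->
  compact_open E -> compact_open [set A *m x | x in E].
Proof.
move=> Au [h [r [h0 Eh Er]]].
have [C C1 AC] := mx_bound A; have [C' C'1 AC'] := mx_bound (invmx A).
have C'0 : 0 < C' by rewrite (lt_le_trans ltr01).
have C0 : 0 < C by rewrite (lt_le_trans ltr01).
exists (h / C'), (C * `|r|); split; first by rewrite divr_gt0.
  move=> _ y [x Ex <-] yh; exists (x + invmx A *m y).
    apply: Eh => //; rewrite -[h](divfK (lt0r_neq0 C'0)) mulrC.
    by apply: polydisc_mulmx => //; [rewrite divr_ge0 ?ltW|exact: ltW].
  by rewrite mulmxDr mulKVmx.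
move=> _ [x Ex <-]; apply: polydisc_mulmx => //; first exact: ltW.
by apply: le_polydisc (Er _ Ex); exact: ler_norm.
Qed.

(** The group of cosets of the polydisc of radius [h] in that of radius [r].
    The projection is total, with arbitrary values off the large polydisc. *)
Record polydisc_quotient k (h r : R) := PolydiscQuotient {
  pq_type :> finZmodType ;
  pq_proj : 'cV[K]_k -> pq_type ;
  pq_rep : pq_type -> 'cV[K]_k ;
  pq_rep_polydisc : forall q, polydisc r (pq_rep q) ;
  pq_repK : cancel pq_rep pq_proj ;
  pq_projD : forall x y, polydisc r x -> polydisc r y ->
    pq_proj (x + y) = pq_proj x + pq_proj y ;
  pq_proj_eq : forall x y, polydisc r x -> polydisc r y ->
    pq_proj x = pq_proj y <-> polydisc h (x - y) }.

Lemma polydisc_quotientP k h r : 0 < h -> h <= r -> polydisc_quotient k h r.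
Proof.
move=> h0 hr; have [s scov] := cid (@finite_cover R K k h r h0).
have r0 : 0 <= r by rewrite (le_trans _ hr)// ltW.
have /cid[Q /cid[pr /cid[rep [H1 H2 H3 H4]]]] := exists_finite_quotient
  (@polydisc0 R K k r r0) (@polydiscB R K k r) (@polydisc0 R K k h (ltW h0)) (@polydiscB R K k h)
  (@le_polydisc R K k h r hr) scov.
exact: (PolydiscQuotient H1 H2 H3 H4).
Qed.

Lemma pq_rep_proj k h r (Q : polydisc_quotient k h r) x : polydisc r x ->
  polydisc h (pq_rep (pq_proj Q x) - x).
Proof.
move=> xr; apply/(pq_proj_eq Q); rewrite ?pq_repK//; exact: pq_rep_polydisc.
Qed.

Lemma pq_projB k h r (Q : polydisc_quotient k h r) x y : polydisc r x -> polydisc r y ->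
  pq_proj Q (x - y) = pq_proj Q x - pq_proj Q y.
Proof.
move=> xr yr; apply: (addIr (pq_proj Q y)); rewrite subrK -pq_projD ?subrK//.
exact: polydiscB.
Qed.

Lemma pq_proj0 k h r (Q : polydisc_quotient k h r) : 0 <= r -> pq_proj Q 0 = 0.
Proof.
by move=> r0; rewrite -[X in pq_proj Q X](subrr 0) pq_projB ?subrr//; exact: polydisc0.
Qed.

(** The compatible automorphisms to which [finite_brascamp_lieb] is applied. *)
Lemma quotient_scale k h r (Q : polydisc_quotient k h r) (a : K) :
  h <= r -> absv a = (1 : R) -> exists2 g : {additive Q -> Q}, injective g &
  forall x, polydisc r x -> g (pq_proj Q x) = pq_proj Q (a *: x).
Proof.
move=> hr a1; have sc (b : K) e (x : 'cV[K]_k) : absv b = (1 : R) -> polydisc e x -> polydisc e (b *: x).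
  by move=> b1; apply: polydiscZ; rewrite b1.
pose g0 (q : Q) : Q := pq_proj Q (a *: pq_rep q).
have g0E x : polydisc r x -> g0 (pq_proj Q x) = pq_proj Q (a *: x).
  move=> xr; apply/(pq_proj_eq Q); [apply: sc => //; exact: pq_rep_polydisc|exact: sc|].
  by rewrite -scalerBr; apply: sc => //; exact: pq_rep_proj.
have [g gE] : exists g : {additive Q -> Q}, forall q, g q = g0 q.
  apply: exists_additive => p q; have [pr qr] := (pq_rep_polydisc p, pq_rep_polydisc q).
  rewrite -{1}[p]pq_repK -{1}[q]pq_repK -pq_projB// g0E; last exact: polydiscB.
  by rewrite scalerBr pq_projB//; exact: sc.
exists g => [p q|x xr]; last by rewrite gE g0E.
rewrite !gE /g0 => /(pq_proj_eq Q).
have [pr qr] := (pq_rep_polydisc p, pq_rep_polydisc q).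
have a0 : a != 0 by rewrite -(@absv_gt0 R) a1.
move=> /(_ (sc _ _ _ a1 pr) (sc _ _ _ a1 qr)); rewrite -scalerBr.
move=> /(sc a^-1); rewrite absvV a1 invr1 scalerA mulVf// scale1r => /(_ erefl).
by move=> /(pq_proj_eq Q pr qr); rewrite !pq_repK.
Qed.

Lemma compact_openD k (E F : set 'cV[K]_k) : compact_open E -> compact_open F ->
  compact_open (F `\` E).
Proof.
move=> [h [r [h0 Eh Er]]] [h' [r' [h'0 Fh Fr]]].
exists (Num.min h h'), r'; split; first by rewrite lt_min h0.
  move=> x y [Fx Ex] yh; split.
    by apply: Fh => //; apply: le_polydisc yh; rewrite ge_min lexx orbT.
  by apply: (periodicC Eh) => //; apply: le_polydisc yh; rewrite ge_min lexx.
by move=> x [/Fr].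
Qed.

Lemma indic_nonneg_nonzero_sb k (E : set 'cV[K]_k) : compact_open E -> E !=set0 ->
  nonneg_nonzero_sb (\1_E : 'cV[K]_k -> R).
Proof.
move=> [h [r [h0 Eh Er]]] [x Ex]; split=> //; last first.
  by exists x; rewrite indicE mem_set// oner_eq0.
apply: (@scaled_schwartz_bruhat _ h (Num.max h r)) => //; first by rewrite le_max lexx.
apply: scaled_indic => //; apply: subset_trans Er _; apply: le_polydisc.
by rewrite le_max lexx orbT.
Qed.

End SchwartzBruhat.

Section Volume.
Variables (R : realType) (K : nonArchLocalFieldType R) (k : nat).
Variable mu : {measure set (borel 'cV[mtop K]_k) -> \bar R}.
Hypothesis mu_norm : normalized_haar mu.
Implicit Types (E : set 'cV[K]_k) (r h : R).

Definition volume E : R := fine (mu E).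

Lemma compact_open_measurable E : compact_open E -> measurable (E : set (borel 'cV[mtop K]_k)).
Proof.
move=> [h [r [h0 Eh _]]]; apply: sub_sigma_algebra; exact: periodic_open h0 Eh.
Qed.

Lemma compact_open_compact E : compact_open E -> compact (E : set 'cV[mtop K]_k).
Proof.
move=> [h [r [h0 Eh Er]]].
by apply: subclosed_compact (@compact_polydisc R K k r) Er; exact: periodic_closed h0 Eh.
Qed.

Lemma volE E : compact_open E -> mu E = (volume E)%:E.
Proof.
move=> cE; rewrite /volume fineK// ge0_fin_numE//.
by have [[muC _ _] _] := mu_norm; apply: muC; exact: compact_open_compact.
Qed.

Lemma mul1mx_image E : [set 1%:M *m x | x in E] = E.
Proof.
by apply/seteqP; split=> [_ [x Ex <-]|x Ex]; [rewrite mul1mx|exists x; rewrite ?mul1mx].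
Qed.

Lemma vol_gt0 E : compact_open E -> E !=set0 -> 0 < volume E.
Proof.
move=> cE E0; rewrite -lte_fin -volE//; have [[_ muO _] _] := mu_norm.
by apply: muO => //; case: cE => h [r [h0 Eh _]]; exact: periodic_open h0 Eh.
Qed.

Lemma vol_ge0 E : 0 <= volume E.
Proof. exact: fine_ge0. Qed.

Lemma polydisc_compact_open h : 0 < h -> compact_open (polydisc h : set 'cV[K]_k).
Proof. by move=> h0; exists h, h; split=> //; exact: polydisc_periodic. Qed.

Lemma vol_polydisc1 : volume (polydisc 1) = 1.
Proof. by rewrite /volume; have [_ /= ->] := mu_norm. Qed.

Lemma le_vol E F : compact_open E -> compact_open F -> E `<=` F -> volume E <= volume F.
Proof.
move=> cE cF EF; rewrite -lee_fin -!volE//.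
by apply: le_measure => //; rewrite inE; exact: compact_open_measurable.
Qed.

Lemma translate_compact_open E a : compact_open E -> compact_open [set a + x | x in E].
Proof.
move=> [h [r [h0 Eh Er]]]; have [C C1 aC] := mx_bound a.
exists h, (Num.max r C); split=> // [_ y [x Ex <-] yh|_ [x Ex <-]].
  by exists (x + y); [exact: Eh|rewrite addrA].
apply: polydiscD; last by apply: le_polydisc (Er _ Ex); rewrite le_max lexx.
by move=> i; rewrite le_max aC orbT.
Qed.

Lemma mu_translate E a : compact_open E -> mu [set a + x | x in E] = mu E.
Proof.
by move=> cE; have [[_ _ muT] _] := mu_norm; apply: muT; exact: compact_open_measurable.
Qed.

Lemma lt_vol E F x : compact_open E -> compact_open F -> E `<=` F -> F x -> ~ E x ->
  volume E < volume F.
Proof.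
move=> cE cF EF Fx nEx; have cFE := compact_openD cE cF.
have m := compact_open_measurable.
suff -> : volume F = volume E + volume (F `\` E).
  by rewrite ltrDl; apply: vol_gt0 => //; exists x.
apply: EFin_inj; rewrite EFinD -!(volE)// -measureU; [|exact: m|exact: m|].
  by congr (mu _); rewrite setDUK.
by rewrite setDE setIC -setIA setICl setI0.
Qed.

Section Scale.
Variables (h r : R) (Q : polydisc_quotient K k h r).
Hypotheses (h0 : 0 < h) (hr : h <= r).

(** The integrand is a combination of indicators of translates of the image of
    the small polydisc under [A], and these all have the same measure. *)
Lemma integral_scaled (A : 'M[K]_k) (f : 'cV[K]_k -> R) :
  A \in unitmx -> scaled h r f -> (forall x, 0 <= f x) ->
  (\int[mu]_x (f (invmx A *m x))%:E)%E =
  (volume [set A *m x | x in polydisc h] * \sum_(q : Q) f (pq_rep q))%:E.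
Proof.
move=> Au [fr fh] f0; set D := [set _ | _ in _].
have cD : compact_open D by apply: image_compact_open => //; exact: polydisc_compact_open.
pose D_ (q : Q) := [set A *m pq_rep q + x | x in D].
have cD_ q : compact_open (D_ q) by exact: translate_compact_open.
have inD q x : D_ q x <-> polydisc h (invmx A *m x - pq_rep q).
  split=> [[_ [z zh <-] <-]|xq].
    by rewrite mulmxDr !mulKmx// addrAC subrr add0r.
  exists (A *m (invmx A *m x - pq_rep q)); first by eexists; [exact: xq|].
  by rewrite mulmxBr mulKVmx// subrKC.
have fE x : f (invmx A *m x) = \sum_(q : Q) f (pq_rep q) * \1_(D_ q) x.
  have [xr|xr] := pselect (polydisc r (invmx A *m x)); last first.
    have -> : f (invmx A *m x) = 0 by apply/eqP; apply/negP => /negP /fr.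
    rewrite big1// => q _; rewrite indicE memNset ?mulr0// => /inD xq; apply: xr.
    by rewrite -[_ *m _](subrK (pq_rep q)); apply: polydiscD; [exact: le_polydisc xq|exact: pq_rep_polydisc].
  rewrite (bigD1 (pq_proj Q (invmx A *m x)))//= indicE mem_set; last first.
    by apply/inD/(pq_proj_eq Q); rewrite ?pq_repK//; exact: pq_rep_polydisc.
  rewrite mulr1 big1 ?addr0 => [|q]; last first.
    move=> qx; rewrite indicE memNset ?mulr0// => /inD /(pq_proj_eq Q); rewrite pq_repK.
    by move=> /(_ xr (pq_rep_polydisc q)) xq; rewrite xq eqxx in qx.
  rewrite -[in LHS](subrK (pq_rep (pq_proj Q (invmx A *m x))) (invmx A *m x)) addrC fh//.
  by apply/(pq_proj_eq Q); rewrite ?pq_repK//; exact: pq_rep_polydisc.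
under eq_integral do rewrite fE -sumEFin.
rewrite ge0_integral_sum//; last first.
- by move=> q x _; rewrite lee_fin mulr_ge0.
- move=> q; apply/measurable_EFinP; apply: measurable_funM => //.
  by apply: measurable_indic; exact: compact_open_measurable.
rewrite mulr_sumr -sumEFin; apply: eq_bigr => q _.
rewrite (@integralZl_indic _ _ _ mu setT _ (fun=> (D_ q : set (borel 'cV[mtop K]_k))))//; last first.
- exact: compact_open_measurable.
- by move=> fq; have := f0 (pq_rep q); rewrite leNgt fq.
rewrite integral_indic//; last exact: compact_open_measurable.
by rewrite setIT mu_translate// volE// -EFinM mulrC.
Qed.

Lemma vol_image_scale (A : 'M[K]_k) E : A \in unitmx -> periodic h E -> E `<=` polydisc r ->
  volume [set A *m x | x in E] =
  volume [set A *m x | x in polydisc h] * \sum_(q : Q) (\1_E (pq_rep q) : R).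
Proof.
move=> Au Eh Er; have cE : compact_open E by exists h, r.
have cAE := image_compact_open Au cE.
apply: EFin_inj; rewrite -integral_scaled//; last exact: scaled_indic.
rewrite -volE//.
transitivity (\int[mu]_x (\1_[set A *m x | x in E] x)%:E)%E.
  by rewrite integral_indic ?setIT//; exact: compact_open_measurable.
apply: eq_integral => x _; rewrite !indicE; congr (nat_of_bool _)%:R%:E.
apply/idP/idP => /set_mem xE; apply/mem_set.
  by case: xE => z zE <-; rewrite mulKmx.
by exists (invmx A *m x) => //; rewrite mulKVmx.
Qed.

Lemma integral_quotient (f : 'cV[K]_k -> R) : scaled h r f -> (forall x, 0 <= f x) ->
  (\int[mu]_x (f x)%:E)%E =
  (volume (polydisc h) * \sum_(q : Q) f (pq_rep q))%:E.
Proof.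
move=> fs f0; rewrite -[in RHS](mul1mx_image (polydisc h)) -(integral_scaled (unitmx1 _ _) fs f0).
by apply: eq_integral => x _; rewrite invmx1 mul1mx.
Qed.

Lemma vol_quotient E : periodic h E -> E `<=` polydisc r ->
  volume E = volume (polydisc h) * \sum_(q : Q) (\1_E (pq_rep q) : R).
Proof.
move=> Eh Er; have := vol_image_scale (unitmx1 _ _) Eh Er.
by rewrite !mul1mx_image.
Qed.

End Scale.

(** Both [E] and the unit polydisc are finite unions of cosets of a small
    polydisc [D], and their images under [A] are unions of as many translates of
    [A D]; so [A] multiplies all volumes by the same factor. *)
Lemma vol_image (A : 'M[K]_k) E : A \in unitmx -> compact_open E ->
  volume [set A *m x | x in E] = volume [set A *m x | x in polydisc 1] * volume E.
Proof.
move=> Au [h' [r' [h'0 Eh' Er']]].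
pose h := Num.min h' 1; pose r := Num.max r' 1.
have h0 : 0 < h by rewrite lt_min h'0/=.
have h1 : h <= 1 by rewrite ge_min lexx orbT.
have r1 : 1 <= r by rewrite le_max lexx orbT.
have hr := le_trans h1 r1.
have Eh : periodic h E by move=> x y Ex yh; apply: Eh' => //; apply: le_polydisc yh; rewrite ge_min lexx.
have Er : E `<=` polydisc r by apply: subset_trans Er' _; apply: le_polydisc; rewrite le_max lexx.
pose Q := polydisc_quotientP K k h0 hr.
have P1h := @polydisc_periodic R K k h 1 h1.
have P1r := @le_polydisc R K k 1 r r1.
rewrite (vol_quotient Q h0 hr Eh Er).
have := vol_quotient Q h0 hr P1h P1r; rewrite vol_polydisc1 => e1.
have V := vol_image_scale Q h0 hr Au.
rewrite (V _ Eh Er) (V _ P1h P1r).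
have F (a b x y : R) : 1 = x * y -> a * b = a * y * (x * b).
  by move=> xy; rewrite -[LHS]mulr1 xy; ring.
exact: F.
Qed.

End Volume.

(** * Lattices and dominant minors *)

Section ValuedLinearAlgebra.
Variables (R : realType) (K : nonArchLocalFieldType R).
Implicit Types (k : nat) (r h e : R).

(** The gap in the value group makes strictly increasing sequences of absolute
    values grow geometrically. *)
Lemma max_absv (S : set K) (x0 : K) r : S x0 -> x0 != 0 ->
  (forall x, S x -> absv x <= r) -> exists2 x, S x & forall y, S y -> absv y <= absv x :> R.
Proof.
move=> Sx0 x00 Sr; apply: contrapT => nomax.
have [p /andP[p0 p1] pgap] := uniformizer K.
have grow x : S x -> exists2 y, S y & absv x <= absv p * absv y.
  move=> Sx; apply: contrapT => noy; apply: nomax; exists x => // y Sy.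
  rewrite leNgt; apply/negP => xy; apply: noy; exists y => //.
  have y0 : 0 < absv y :> R by apply: le_lt_trans xy; exact: absv_ge0.
  rewrite -ler_pdivrMr// -absvV -absvM; apply: pgap.
  by rewrite absvM absvV ltr_pdivrMr// mul1r.
have growN N : exists2 y, S y & absv x0 <= absv p ^+ N * absv y.
  elim: N => [|N [y Sy x0y]]; first by exists x0; rewrite // expr0 mul1r.
  have [z Sz yz] := grow y Sy; exists z => //; apply: le_trans x0y _.
  by rewrite exprSr -mulrA ler_wpM2l// exprn_ge0// ltW.
have r0 : 0 < r by apply: lt_le_trans (Sr _ Sx0); rewrite absv_gt0.
have p01 : 0 < absv p < (1 : R) by rewrite p0.
have e0 : 0 < absv x0 / r by rewrite divr_gt0// absv_gt0.
have [N] := expr_lt_eventually p01 e0; rewrite ltr_pdivlMr//.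
have [y Sy x0y] := growN N; apply/negP; rewrite -leNgt (le_trans x0y)//.
by rewrite ler_wpM2l ?Sr// exprn_ge0// ltW.
Qed.

(** The invertible matrices over the ring of integers, described by their action
    on polydiscs. *)
Definition isometric k (U : 'M[K]_k) :=
  forall r x, polydisc r (U *m x) <-> polydisc r x.

Definition integral_mx k l (A : 'M[K]_(k, l)) := forall i j, absv (A i j) <= (1 : R).

Lemma polydisc_ge0 k r (x : 'cV[K]_k) (i : 'I_k) : polydisc r x -> 0 <= r.
Proof. by move=> /(_ i); apply: le_trans; exact: absv_ge0. Qed.

Lemma integral_polydisc k r (A : 'M[K]_k) x : integral_mx A ->
  polydisc r x -> polydisc r (A *m x).
Proof.
move=> A1 xr i; rewrite mxE; apply: absv_sum => [|j _]; first exact: polydisc_ge0 xr.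
by rewrite absvM (le_trans _ (xr j))// ler_piMl ?absv_ge0.
Qed.

Lemma isometric_integral k (U V : 'M[K]_k) : integral_mx U -> integral_mx V ->
  V *m U = 1%:M -> isometric U.
Proof.
move=> U1 V1 VU r x; split; last exact: integral_polydisc.
by move=> /(integral_polydisc V1); rewrite mulmxA VU mul1mx.
Qed.

Lemma isometric_mulmx k (U V : 'M[K]_k) : isometric U -> isometric V -> isometric (U *m V).
Proof. by move=> iU iV r x; rewrite -mulmxA iU; exact: iV. Qed.

Lemma isometric1 k : isometric (1%:M : 'M[K]_k).
Proof. by move=> r x; rewrite mul1mx. Qed.

Lemma isometric_unit k (U : 'M[K]_k) : isometric U -> U \in unitmx.
Proof.
move=> iU; rewrite -unitmx_tr -row_free_unit; apply: inj_row_free => v vU.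
have : polydisc 0 (U *m v^T).
  by rewrite -[U]trmxK -trmx_mul vU trmx0; exact: polydisc0.
rewrite iU => v0; apply/rowP => i; rewrite mxE; apply/(@absv_eq0 R).
by apply/eqP; rewrite eq_le absv_ge0 andbT; have := v0 i; rewrite mxE.
Qed.

Lemma isometric_inv k (U : 'M[K]_k) : isometric U -> isometric (invmx U).
Proof.
by move=> iU r x; rewrite -(iU r (invmx U *m x)) mulKVmx// isometric_unit.
Qed.

Lemma isometric_image k (U : 'M[K]_k) r : isometric U ->
  [set U *m x | x in polydisc r] = polydisc r.
Proof.
move=> iU; apply/seteqP; split=> [_ [x xr <-]|x xr]; first exact/iU.
by exists (invmx U *m x); [exact/(isometric_inv iU)|rewrite mulKVmx// isometric_unit].
Qed.

(** The largest coordinate of [x] exceeds all coordinates of [E *m x], so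
    it survives in the sum. *)
Lemma isometric_near1 k (E : 'M[K]_k) e : e < 1 -> (forall i j, absv (E i j) <= e) ->
  isometric (1%:M + E).
Proof.
move=> e1 Ee r x; split=> xr; last first.
  rewrite mulmxDl mul1mx; apply: polydiscD => //; apply: integral_polydisc => // i j.
  by rewrite (le_trans (Ee i j))// ltW.
move=> i; have [i0 _ i0max] := @arg_maxP _ _ _ i xpredT (fun i => absv (x i 0) : R) isT.
apply: le_trans (i0max i isT) _.
have e0 : 0 <= e by apply: le_trans (Ee i i); exact: absv_ge0.
have : absv (x i0 0) <= Num.max r (e * absv (x i0 0)).
  rewrite {1}(_ : x i0 0 = ((1%:M + E) *m x) i0 0 - (E *m x) i0 0); last first.
    by rewrite mulmxDl mul1mx mxE addrK.
  apply: absvB; first by rewrite le_max xr.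
  rewrite le_max; apply/orP; right; rewrite mxE; apply: absv_sum => [|j _].
    by rewrite mulr_ge0// absv_ge0.
  by rewrite absvM ler_pM ?absv_ge0//; exact: i0max.
rewrite le_max => /orP[//|].
have := absv_ge0 (x i0 0); rewrite le_eqVlt => /predU1P[x0 _|x0].
  by rewrite -x0; exact: polydisc_ge0 xr.
by rewrite leNgt -[X in _ < X]mul1r ltr_pM2r// e1.
Qed.

Definition setcol k (A : 'M[K]_k) i (x : 'cV[K]_k) : 'M[K]_k :=
  \matrix_(a, b) if b == i then x a 0 else A a b.

Lemma det_setcol k (A : 'M[K]_k) i x : \det (setcol A i x) = (\adj A *m x) i 0.
Proof.
rewrite (expand_det_col _ i) mxE; apply: eq_bigr => a _.
rewrite !mxE eqxx mulrC; congr (_ * _); rewrite /cofactor; congr (_ * \det _).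
by apply/matrixP => b c; rewrite !mxE eq_sym (negbTE (neq_lift _ _)).
Qed.

(** Cramer's rule: the coordinates of [x] in the basis [A] are the quotients of
    [\det (setcol A i x)] by [\det A]. *)
Lemma maximal_det_coords k (A : 'M[K]_k) x : A \in unitmx ->
  (forall i, absv (\det (setcol A i x)) <= absv (\det A) :> R) ->
  polydisc 1 (invmx A *m x).
Proof.
move=> Au Amax i; have := Amax i.
have -> : \det (setcol A i x) = \det A * (invmx A *m x) i 0.
  rewrite det_setcol -{1}[x](mulKVmx Au) [\adj A *m _]mulmxA mul_adj_mx.
  by rewrite mul_scalar_mx mxE.
rewrite absvM.
rewrite unitmxE unitfE -(@absv_gt0 R) in Au.
by rewrite ger_pMr.
Qed.

Definition omodule k (M : set 'cV[K]_k) :=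
  [/\ M 0, forall x y, M x -> M y -> M (x + y) &
      forall (a : K) x, absv a <= (1 : R) -> M x -> M (a *: x)].

Lemma absv_sub1 (a : K) : absv a < (1 : R) -> absv (a - 1) = 1 :> R.
Proof.
move=> a1; apply/eqP; rewrite eq_le; apply/andP; split.
  by apply: absvB; [exact: ltW|rewrite absv1].
rewrite leNgt; apply/negP => a11; have := absvD_max a (1 - a).
by rewrite subrKC absv1 -(absvN (1 - a)) opprB leNgt gt_max a1 a11.
Qed.

(** A non-unit of the ring of integers is 1 plus a unit. *)
Lemma omodule_units k (E : set 'cV[K]_k) : E 0 -> (forall x y, E x -> E y -> E (x + y)) ->
  (forall a x, absv a = (1 : R) -> E x -> E (a *: x)) -> omodule E.
Proof.
move=> E0 ED EU; split=> // a x; rewrite le_eqVlt => /predU1P[|a1 Ex]; first exact: EU.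
rewrite -[a](subrK 1) scalerDl; apply: ED; last by rewrite scale1r.
by apply: EU => //; exact: absv_sub1.
Qed.

Lemma omodule_mulmx k l (M : set 'cV[K]_k) (A : 'M[K]_(k, l)) x : omodule M ->
  (forall j, M (col j A)) -> polydisc 1 x -> M (A *m x).
Proof.
move=> [M0 MD MZ] MA x1.
have -> : A *m x = \sum_j x j 0 *: col j A.
  apply/colP => i; rewrite mxE summxE; apply: eq_bigr => j _.
  by rewrite !mxE mulrC.
by elim/big_ind : _ => // j _; exact: MZ.
Qed.

Lemma absv_det k (A : 'M[K]_k) r : 0 <= r -> (forall i j, absv (A i j) <= r) ->
  absv (\det A) <= r ^+ k.
Proof.
move=> r0 Ar; apply: absv_sum => [|s _]; first exact: exprn_ge0.
rewrite absvM absvX absvN absv1 expr1n mul1r absv_prod.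
rewrite -[X in _ ^+ X]card_ord -prodr_const.
by apply: ler_prod => i _; rewrite absv_ge0 Ar.
Qed.

(** Choose vectors of [M] whose determinant has maximal absolute value; exchanging
    one of them for another element of [M] does not increase it, so
    [maximal_det_coords] applies to every element of [M]. *)
Lemma lattice_basis k (M : set 'cV[K]_k) : compact_open M -> omodule M ->
  exists2 A : 'M[K]_k, A \in unitmx & M = [set A *m x | x in polydisc 1].
Proof.
move=> [h [r [h0 Mh Mr]]] oM; have [M0 _ _] := oM.
pose S := [set a | exists2 A : 'M[K]_k, (forall j, M (col j A)) & a = \det A].
have [a a0 ah] := small_element K h0.
have Sa : S (\det (a%:M : 'M[K]_k)).
  exists a%:M => // j; rewrite -[col _ _]add0r; apply: Mh => // i.
  by rewrite !mxE; case: (i == j); rewrite ?mulr1n ?mulr0n ?absv0 ltW.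
have da0 : \det (a%:M : 'M[K]_k) != 0 by rewrite det_scalar expf_neq0.
have Sb x : S x -> absv x <= `|r| ^+ k.
  move=> [A AM ->]; apply: absv_det => // i j.
  by have /Mr/(_ i) := AM j; rewrite mxE => /le_trans; apply; exact: ler_norm.
have [_ [A AM ->] Amax] := max_absv Sa da0 Sb.
have Au : A \in unitmx.
  rewrite unitmxE unitfE -(@absv_gt0 R); apply: lt_le_trans (Amax _ Sa).
  by rewrite absv_gt0.
exists A => //; apply/seteqP; split=> [x Mx|_ [x x1 <-]]; last exact: omodule_mulmx.
exists (invmx A *m x); last by rewrite mulKVmx.
apply: maximal_det_coords => // i; apply: Amax; exists (setcol A i x) => // j.
have [->|ji] := eqVneq j i.
  by rewrite (_ : col _ _ = x)//; apply/colP => b; rewrite !mxE eqxx.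
by rewrite (_ : col _ _ = col j A)//; apply/colP => b; rewrite !mxE (negbTE ji).
Qed.

(** The exchange argument of [lattice_basis], among the columns of [B]. *)
Lemma image_colsub d n (B : 'M[K]_(d, n)) (s : {ffun 'I_d -> 'I_n}) :
  colsub s B \in unitmx ->
  (forall s' : {ffun 'I_d -> 'I_n},
     absv (\det (colsub s' B)) <= absv (\det (colsub s B)) :> R) ->
  [set B *m x | x in polydisc 1] = [set colsub s B *m y | y in polydisc 1].
Proof.
move=> su smax; apply/seteqP; split=> _ [x x1 <-].
  exists (invmx (colsub s B) *m (B *m x)); last by rewrite mulKVmx.
  rewrite mulmxA; apply: omodule_mulmx x1.
    split=> [|y z|a y]; [exact: polydisc0|exact: polydiscD|exact: polydiscZ].
  move=> l; rewrite colE -mulmxA -colE; apply: maximal_det_coords => // i.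
  rewrite (_ : setcol _ _ _ = colsub [ffun j => if j == i then l else s j] B)//.
  by apply/matrixP => a b; rewrite !mxE ffunE; case: eqP.
exists (colsub s 1%:M *m x); last by rewrite mulmxA mulmx_colsub mulmx1.
apply: omodule_mulmx x1.
  split=> [|y z|a y]; [exact: polydisc0|exact: polydiscD|exact: polydiscZ].
by move=> j i; rewrite !mxE; case: (_ == _); rewrite ?mulr1n ?mulr0n ?absv0 ?absv1.
Qed.

Lemma exists_colsub_unit d n (B : 'M[K]_(d, n)) : row_free B ->
  exists s : {ffun 'I_d -> 'I_n}, colsub s B \in unitmx.
Proof.
move=> Bfree; have fB : row_full B^T by rewrite /row_full mxrank_tr.
exists (fullrankfun fB); rewrite -unitmx_tr.
suff -> : (colsub (fullrankfun fB) B)^T = rowsub (fullrankfun fB) B^T by exact: fullrowsub_unit.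
by apply/matrixP => i j; rewrite !mxE.
Qed.

Lemma isometric_perm k (s : 'S_k) : isometric (perm_mx s : 'M[K]_k).
Proof.
have P1 (t : 'S_k) : integral_mx (perm_mx t : 'M[K]_k).
  by move=> i j; rewrite !mxE; case: (_ == _); rewrite ?absv0 ?absv1.
apply: (isometric_integral (V := perm_mx s^-1)) => //.
by rewrite -perm_mxM mulVg perm_mx1.
Qed.

Lemma integral_block k l (A : 'M[K]_k) (B : 'M[K]_(k, l)) (C : 'M[K]_(l, k)) (D : 'M[K]_l) :
  integral_mx A -> integral_mx B -> integral_mx C -> integral_mx D ->
  integral_mx (block_mx A B C D).
Proof.
move=> A1 B1 C1 D1 i j; rewrite !mxE.
by case: (splitP i) => ? _; rewrite !mxE; case: (splitP j).
Qed.

Lemma integral0 k l : integral_mx (0 : 'M[K]_(k, l)).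
Proof. by move=> i j; rewrite mxE absv0. Qed.

Lemma integral1 k : integral_mx (1%:M : 'M[K]_k).
Proof. by move=> i j; rewrite mxE; case: (_ == _); rewrite ?absv0 ?absv1. Qed.

Lemma integralN k l (A : 'M[K]_(k, l)) : integral_mx A -> integral_mx (- A).
Proof. by move=> A1 i j; rewrite mxE absvN. Qed.

Lemma isometric_lower k l (C : 'M[K]_(l, k)) : integral_mx C ->
  isometric (block_mx 1%:M 0 C 1%:M).
Proof.
move=> C1; apply: (isometric_integral (V := block_mx 1%:M 0 (- C) 1%:M)).
- by apply: integral_block => //; [exact: integral1|exact: integral0|exact: integral1].
- by apply: integral_block => //; [exact: integral1|exact: integral0|exact: integralN|exact: integral1].
rewrite mulmx_block !mulmx1 !mul1mx !mul0mx !mulmx0 !addr0 !add0r addNr.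
by rewrite -scalar_mx_block.
Qed.

Lemma isometric_upper k l (B : 'M[K]_(k, l)) : integral_mx B ->
  isometric (block_mx 1%:M B 0 1%:M).
Proof.
move=> B1; apply: (isometric_integral (V := block_mx 1%:M (- B) 0 1%:M)).
- by apply: integral_block => //; [exact: integral1|exact: integral0|exact: integral1].
- by apply: integral_block => //; [exact: integral1|exact: integralN|exact: integral0|exact: integral1].
rewrite mulmx_block !mulmx1 !mul1mx !mul0mx !mulmx0 !addr0 !add0r subrr.
by rewrite -scalar_mx_block.
Qed.

Lemma polydisc_col_mx k l r (u : 'cV[K]_k) (v : 'cV[K]_l) :
  polydisc r (col_mx u v) <-> polydisc r u /\ polydisc r v.
Proof.
split=> [uv|[ur vr] i]; last by rewrite mxE; case: splitP.
by split=> i; [have := uv (lshift l i); rewrite col_mxEu|have := uv (rshift k i); rewrite col_mxEd].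
Qed.

Lemma isometric_block k l (U : 'M[K]_k) (V : 'M[K]_l) : isometric U -> isometric V ->
  isometric (block_mx U 0 0 V).
Proof.
move=> iU iV r x; rewrite -[x]vsubmxK mul_block_col !mul0mx addr0 add0r.
by rewrite !polydisc_col_mx (iU r) (iV r).
Qed.

(** Gaussian elimination in which the pivot is an entry of largest absolute
    value: all multipliers are then integral, so the elimination matrices are
    isometric. *)
Lemma smith n (A : 'M[K]_n) : exists P Q : 'M[K]_n, exists x : 'rV[K]_n,
  [/\ isometric P, isometric Q & A = P *m diag_mx x *m Q].
Proof.
elim: n => [|n IH] in A *.
  exists 1%:M, 1%:M, 0; split; try exact: isometric1.
  by apply/matrixP => -[].
have [[i0 j0] _ maxA] := @arg_maxP _ _ _ (ord0, ord0) xpredT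
  (fun ij : 'I_n.+1 * 'I_n.+1 => absv (A ij.1 ij.2) : R) isT.
have {}maxA i j : absv (A i j) <= absv (A i0 j0) :> R by exact: (maxA (i, j)).
have [a0|a0] := eqVneq (A i0 j0) 0.
  exists 1%:M, 1%:M, 0; split; try exact: isometric1.
  rewrite linear0 mulmx0 mul0mx; apply/matrixP => i j; rewrite mxE; apply/(@absv_eq0 R).
  by apply/eqP; rewrite eq_le absv_ge0 andbT (le_trans (maxA i j))// a0 absv0.
pose s := tperm ord0 i0; pose t := tperm ord0 j0.
pose B := perm_mx s *m A *m perm_mx t.
have BE i j : B i j = A (s i) (t j).
  by rewrite /B -row_permE -[X in perm_mx X](tpermV ord0 j0 : _ = t) -col_permE !mxE.
have AE : A = perm_mx s *m B *m perm_mx t.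
  rewrite /B !mulmxA -perm_mxM tperm2 perm_mx1 mul1mx -!mulmxA -perm_mxM tperm2.
  by rewrite perm_mx1 mulmx1.
clearbody B; set a := A i0 j0 in a0 maxA.
have B00 : B ord0 ord0 = a by rewrite BE !tpermL.
pose B' : 'M[K]_(1 + n) := B.
pose v := ursubmx B'; pose w := dlsubmx B'; pose C := drsubmx B'.
have Ba : B' = block_mx a%:M v w C.
  rewrite -[LHS]submxK; congr block_mx; apply/matrixP => i j.
  rewrite !ord1 !mxE eqxx mulr1n -B00; congr (fun_of_matrix B _ _); exact: val_inj.
have small l l' (D : 'M[K]_(l, l')) (f : 'I_l -> 'I_n.+1) (g : 'I_l' -> 'I_n.+1) :
    (forall i j, D i j = B (f i) (g j)) -> integral_mx (a^-1 *: D).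
  move=> DE i j; rewrite mxE absvM absvV mulrC ler_pdivrMr ?absv_gt0// mul1r.
  by rewrite DE BE.
have v1 : integral_mx (a^-1 *: v).
  by apply: (small _ _ _ (@lshift 1 n) (@rshift 1 n)) => i j; rewrite !mxE.
have w1 : integral_mx (a^-1 *: w).
  by apply: (small _ _ _ (@rshift 1 n) (@lshift 1 n)) => i j; rewrite !mxE.
have [P [Q [x [iP iQ CE]]]] := IH (C - w *m (a^-1 *: v)).
exists (perm_mx s *m (block_mx 1%:M 0 (a^-1 *: w) 1%:M *m block_mx 1%:M 0 0 P)).
exists (block_mx 1%:M 0 0 Q *m block_mx 1%:M (a^-1 *: v) 0 1%:M *m perm_mx t).
exists (row_mx (const_mx a : 'rV_1) x); split.
- apply: isometric_mulmx; first exact: isometric_perm.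
  apply: isometric_mulmx; first exact: (@isometric_lower 1 n).
  by apply: (@isometric_block 1 n) => //; exact: isometric1.
- apply: isometric_mulmx; last exact: isometric_perm.
  apply: isometric_mulmx; last exact: (@isometric_upper 1 n).
  by apply: (@isometric_block 1 n) => //; exact: isometric1.
rewrite {1}AE -/B' Ba; set Dx := diag_mx x in CE *.
have -> : @diag_mx K n.+1 (row_mx (const_mx a : 'rV_1) x) = @block_mx K 1 n 1 n a%:M 0 0 Dx.
  by rewrite -diag_const_mx; exact: (@diag_mx_row K n 1).
have -> : block_mx a%:M v w C = block_mx 1%:M 0 (a^-1 *: w) 1%:M *m
  (block_mx 1%:M 0 0 P *m block_mx a%:M 0 0 Dx *m block_mx 1%:M 0 0 Q) *m
  block_mx 1%:M (a^-1 *: v) 0 1%:M.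
  rewrite !mulmx_block !(mulmx0, mul0mx, mulmx1, mul1mx, addr0, add0r) -CE.
  rewrite mul_scalar_mx mul_mx_scalar !scalerA divff// !scale1r.
  by rewrite [w *m _ + _]addrC subrK.
by rewrite !mulmxA.
Qed.

End ValuedLinearAlgebra.

(** * Lattice volumes *)

Section LatticeVolume.
Variables (R : realType) (K : nonArchLocalFieldType R).
Variable mu : forall k, {measure set (borel 'cV[mtop K]_k) -> \bar R}.
Hypothesis mu_haar : forall k, normalized_haar (mu k).
Implicit Types (k l : nat).

Local Notation vol E := (volume (mu _) E).

Definition lattice k l (A : 'M[K]_(k, l)) : set 'cV[K]_k :=
  [set A *m x | x in polydisc 1].

Lemma lattice_mulmx k l (A : 'M[K]_k) (B : 'M[K]_(k, l)) :
  lattice (A *m B) = [set A *m x | x in lattice B].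
Proof.
apply/seteqP; split=> [_ [x x1 <-]|_ [_ [x x1 <-] <-]].
  by exists (B *m x); [exists x|rewrite mulmxA].
by exists x; rewrite ?mulmxA.
Qed.

Lemma lattice_isometric k l (A : 'M[K]_(k, l)) (U : 'M[K]_l) : isometric U ->
  lattice (A *m U) = lattice A.
Proof.
move=> iU; apply/seteqP; split=> [_ [x x1 <-]|_ [x x1 <-]].
  by exists (U *m x); [exact/iU|rewrite mulmxA].
exists (invmx U *m x); first exact/(isometric_inv iU).
by rewrite -mulmxA mulKVmx// isometric_unit.
Qed.

Lemma lattice_compact_open k (A : 'M[K]_k) : A \in unitmx -> compact_open (lattice A).
Proof.
by move=> Au; apply: image_compact_open => //; exact: polydisc_compact_open.
Qed.

Lemma lattice_neq0 k l (A : 'M[K]_(k, l)) : lattice A !=set0.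
Proof. by exists 0, 0; [exact: polydisc0|rewrite mulmx0]. Qed.

Lemma vol_lattice_gt0 k (A : 'M[K]_k) : A \in unitmx -> 0 < vol (lattice A).
Proof.
by move=> Au; apply: vol_gt0 => //; [exact: lattice_compact_open|exact: lattice_neq0].
Qed.

Lemma vol_lattice_mulmx k (A B : 'M[K]_k) : A \in unitmx -> B \in unitmx ->
  vol (lattice (A *m B)) = vol (lattice A) * vol (lattice B).
Proof.
move=> Au Bu; rewrite lattice_mulmx vol_image//; exact: lattice_compact_open.
Qed.

Lemma vol_lattice_isometric k (U : 'M[K]_k) : isometric U -> vol (lattice U) = 1.
Proof. by move=> iU; rewrite /lattice isometric_image// vol_polydisc1. Qed.

Definition dominant k l (s : {ffun 'I_k -> 'I_l}) (A : 'M[K]_(k, l)) :=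
  colsub s A \in unitmx /\ forall s' : {ffun 'I_k -> 'I_l},
    absv (\det (colsub s' A)) <= absv (\det (colsub s A)) :> R.

Lemma exists_dominant k l (A : 'M[K]_(k, l)) : row_free A ->
  exists s : {ffun 'I_k -> 'I_l}, dominant s A.
Proof.
move=> /exists_colsub_unit[s0 s0u].
have [s _ smax] := @arg_maxP _ _ _ s0 xpredT
  (fun s : {ffun 'I_k -> 'I_l} => absv (\det (colsub s A)) : R) isT.
exists s; split=> [|s']; last exact: smax.
rewrite unitmxE unitfE -(@absv_gt0 R); apply: lt_le_trans (smax s0 isT).
by rewrite absv_gt0 -unitfE -unitmxE.
Qed.

Lemma lattice_dominant k l (s : {ffun 'I_k -> 'I_l}) (A : 'M[K]_(k, l)) :
  dominant s A -> lattice A = lattice (colsub s A).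
Proof. by move=> [su smax]; exact: image_colsub. Qed.

Lemma lattice_colsub k l (s : {ffun 'I_k -> 'I_l}) (A : 'M[K]_(k, l)) :
  lattice (colsub s A) `<=` lattice A.
Proof.
move=> _ [x x1 <-]; exists (colsub s 1%:M *m x); last by rewrite mulmxA mulmx_colsub mulmx1.
apply: omodule_mulmx x1.
  split=> [|y z|a y]; [exact: polydisc0|exact: polydiscD|exact: polydiscZ].
by move=> j i; rewrite !mxE; case: (_ == _); rewrite ?mulr1n ?mulr0n ?absv0 ?absv1.
Qed.

Lemma row_free_compact_open k l (A : 'M[K]_(k, l)) : row_free A -> compact_open (lattice A).
Proof.
move=> /exists_dominant[s sA]; rewrite (lattice_dominant sA).
by apply: lattice_compact_open; case: sA.
Qed.

(** The diagonal factor that the columns selected by [s] receive when all columns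
    are scaled by [x]. *)
Definition dsel k l (s : {ffun 'I_k -> 'I_l}) (x : 'rV[K]_l) : 'M[K]_k :=
  diag_mx (\row_i x 0 (s i)).

Lemma colsub_diag k l (s : {ffun 'I_k -> 'I_l}) (A : 'M[K]_(k, l)) x :
  colsub s (A *m diag_mx x) = colsub s A *m dsel s x.
Proof. by apply/matrixP => i j; rewrite !mul_mx_diag !mxE. Qed.

Lemma row_free_mul_unit k l (A : 'M[K]_(k, l)) (B : 'M[K]_l) : row_free A -> B \in unitmx ->
  row_free (A *m B).
Proof. by move=> Af Bu; rewrite /row_free mxrankMfree// row_free_unit. Qed.

Section LatticeRatio.
Variables (n m : nat) (d : 'I_m -> nat) (M : forall j, 'M[K]_(d j, n)) (c : 'I_m -> R).
Hypothesis c0 : forall j, 0 <= c j.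
Hypothesis Mfree : forall j, c j != 0 -> row_free (M j).

(** A lower bound for the quotient [BL_at] of the tuple of indicators of the
    lattices [lattice (M j *m A)], with the same supremum over [A]. *)
Definition lattice_ratio (A : 'M[K]_n) : R :=
  vol (lattice A) / \prod_(j < m) vol (lattice (M j *m A)) `^ c j.

Lemma lattice_ratioE A : lattice_ratio A =
  vol (lattice A) / \prod_(j < m) vol (lattice (M j *m A)) `^ c j.
Proof. by []. Qed.

Lemma vol_pow_gt0 (A : 'M[K]_n) j : A \in unitmx -> 0 < vol (lattice (M j *m A)) `^ c j.
Proof.
move=> Au; have [->|cj] := eqVneq (c j) 0; first by rewrite powRr0.
rewrite powR_gt0// vol_gt0//; last exact: lattice_neq0.
by apply: row_free_compact_open; apply: row_free_mul_unit => //; exact: Mfree.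
Qed.

Lemma lattice_ratio_gt0 A : A \in unitmx -> 0 < lattice_ratio A.
Proof.
move=> Au; rewrite divr_gt0 ?vol_lattice_gt0//.
by apply: prodr_gt0 => j _; exact: vol_pow_gt0.
Qed.

Lemma lattice_ratio_le (A B : 'M[K]_n) : A \in unitmx -> B \in unitmx ->
  vol (lattice A) <= vol (lattice B) ->
  (forall j, c j != 0 -> vol (lattice (M j *m B)) <= vol (lattice (M j *m A))) ->
  lattice_ratio A <= lattice_ratio B.
Proof.
move=> Au Bu AB MAB; apply: ler_pM => //.
- exact: vol_ge0.
- by rewrite invr_ge0 prodr_ge0// => j _; exact: powR_ge0.
rewrite lef_pV2 ?posrE; try by apply: prodr_gt0 => j _; exact: vol_pow_gt0.
apply: ler_prod => j _; rewrite powR_ge0/=.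
have [->|cj] := eqVneq (c j) 0; first by rewrite !powRr0.
by apply: ge0_ler_powR; rewrite ?nnegrE ?vol_ge0 ?MAB.
Qed.

Lemma lattice_ratio_isometric A U : isometric U ->
  lattice_ratio (A *m U) = lattice_ratio A.
Proof.
move=> iU; rewrite !lattice_ratioE (lattice_isometric A iU); congr (_ / _).
by apply: eq_bigr => j _; rewrite mulmxA (lattice_isometric _ iU).
Qed.

(** Let the columns [s] be dominant in [M j *m P0 *m diag_mx x]. For [P] near
    [P0] the corresponding columns of [M j *m P] and [M j *m P0] differ by an
    isometry on the left, while [diag_mx x] acts on the right. Hence they span a
    sublattice of [lattice (M j *m P *m diag_mx x)] whose volume is that of
    [lattice (M j *m P0 *m diag_mx x)], for all [x] at once. *)
Lemma dominated_near (P0 : 'M[K]_n) : isometric P0 -> exists2 e : R, 0 < e &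
  forall P x, isometric P -> (forall i j, absv ((P - P0) i j) <= e) ->
  diag_mx x \in unitmx -> lattice_ratio (P *m diag_mx x) <= lattice_ratio (P0 *m diag_mx x).
Proof.
move=> iP0.
pose ok (js : {j : 'I_m & {ffun 'I_(d j) -> 'I_n}}) e := forall P : 'M[K]_n,
  (forall i j, absv ((P - P0) i j) <= e) ->
  colsub (tagged js) (M (tag js) *m P0) \in unitmx ->
  exists2 U, isometric U & colsub (tagged js) (M (tag js) *m P) =
    U *m colsub (tagged js) (M (tag js) *m P0).
have okS js e e' : e' <= e -> ok js e -> ok js e'.
  by move=> ee oke P Pe; apply: oke => i j; exact: le_trans (Pe i j) ee.
have ex_ok js : exists2 e, 0 < e & ok js e.
  case: js => j s; rewrite /ok /=; set B0 := colsub s (M j *m P0).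
  have [C C1 MC] := mx_bound (M j); have [C' C'1 BC'] := mx_bound (invmx B0).
  have C0 : 0 < C by apply: lt_le_trans C1.
  have C'0 : 0 < C' by apply: lt_le_trans C'1.
  exists (2^-1 / (C * C')); first by rewrite divr_gt0// mulr_gt0.
  move=> P Pe B0u; exists (1%:M + colsub s (M j *m (P - P0)) *m invmx B0); last first.
    rewrite mulmxDl mul1mx mulmxKV// mulmxBr.
    by apply/matrixP => a b; rewrite !mxE addrC subrK.
  apply: (@isometric_near1 _ _ _ _ 2^-1) => [|a b]; first lra.
  rewrite mxE; apply: absv_sum => // l _; rewrite absvM.
  rewrite (_ : 2^-1 = (2^-1 / C') * C'); last by rewrite divfK ?gt_eqF.
  apply: ler_pM; rewrite ?absv_ge0//.
  rewrite !mxE; apply: absv_sum => [|o _]; first by rewrite divr_ge0 ?ltW.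
  rewrite absvM (_ : 2^-1 / C' = C * (2^-1 / (C * C'))); last first.
    by field; rewrite !gt_eqF.
  by apply: ler_pM; rewrite ?absv_ge0.
have [e e0 oke] : exists2 e, 0 < e & forall js, ok js e.
  have /choice[e eP] : forall js, exists e, 0 < e /\ ok js e.
    by move=> js; have [e] := ex_ok js; exists e.
  have [e0 e00 e0e] := finite_lower_bound (fun js => proj1 (eP js)).
  by exists e0 => // js; apply: okS (e0e js) _; case: (eP js).
exists e; first exact: e0.
move=> P x iP Pe xu.
have [Pu P0u] := (isometric_unit iP, isometric_unit iP0).
apply: lattice_ratio_le; rewrite ?unitmx_mul ?Pu ?P0u//.
  by rewrite !vol_lattice_mulmx// (vol_lattice_isometric iP) (vol_lattice_isometric iP0).
move=> j cj; rewrite !mulmxA.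
have MP0f : row_free (M j *m P0 *m diag_mx x).
  by rewrite -mulmxA; apply: row_free_mul_unit; [exact: Mfree|rewrite unitmx_mul P0u].
have MPf : row_free (M j *m P *m diag_mx x).
  by rewrite -mulmxA; apply: row_free_mul_unit; [exact: Mfree|rewrite unitmx_mul Pu].
have [s sdom] := exists_dominant MP0f.
rewrite (lattice_dominant sdom); have [su _] := sdom.
have := su; rewrite colsub_diag unitmx_mul => /andP[B0u Du].
have [U iU UE] := oke (Tagged _ s) P Pe B0u.
apply: (le_trans (y := vol (lattice (colsub s (M j *m P *m diag_mx x))))).
  rewrite !colsub_diag [colsub s (M j *m P)]UE /= -mulmxA (vol_lattice_mulmx (isometric_unit iU)).
    by rewrite (vol_lattice_isometric iU) mul1r.
  by rewrite unitmx_mul B0u.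
apply: le_vol => //; last exact: lattice_colsub.
  apply: lattice_compact_open.
  by rewrite colsub_diag [colsub s (M j *m P)]UE !unitmx_mul isometric_unit// B0u.
exact: row_free_compact_open.
Qed.

End LatticeRatio.
End LatticeVolume.

(** * An optimal lattice *)

Lemma nondecreasing_subsequence (f : nat -> nat) : exists2 g : nat -> nat,
  {homo g : i j / (i < j)%N} & {homo f \o g : i j / (i <= j)%N}.
Proof.
have /choice[a aP] : forall N, exists i, (N <= i)%N /\ forall j, (N <= j)%N -> (f i <= f j)%N.
  move=> N; have ex : exists v, `[< exists2 i, (N <= i)%N & f i = v >].
    by exists (f N); apply/asboolP; exists N.
  have [v /asboolP[k Nk fk] vmin] := ex_minnP ex.
  exists k; split=> // j Nj; rewrite fk; apply: vmin; apply/asboolP; by exists j.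
pose g := fix g n := if n is n'.+1 then a (g n').+1 else a 0%N.
have gS n : (g n < g n.+1)%N by have [] := aP (g n).+1.
have ginc : {homo g : i j / (i < j)%N} by apply: homo_ltn gS; exact: ltn_trans.
have gmin i j : (g i <= j)%N -> (f (g i) <= f j)%N.
  case: i => [|i] /= ij; first by case: (aP 0%N) => _; apply.
  case: (aP (g i).+1) => gi; apply; exact: leq_trans gi ij.
exists g => // i j; rewrite leq_eqVlt => /predU1P[->//|/ginc/ltnW]; exact: gmin.
Qed.

Lemma dickson (I : finType) (f : I -> nat -> nat) :
  exists i j, (i < j)%N /\ forall a, (f a i <= f a j)%N.
Proof.
suff [g ginc gf] : exists2 g : nat -> nat, {homo g : i j / (i < j)%N} &
    forall a, a \in enum I -> {homo f a \o g : i j / (i <= j)%N}.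
  exists (g 0%N), (g 1%N); split=> [|a]; first exact: ginc.
  by apply: (gf a) => //; rewrite mem_enum.
elim: (enum I) => [|a s [g ginc gf]]; first by exists id.
have [h hinc hf] := nondecreasing_subsequence (f a \o g).
exists (g \o h) => [i j /hinc/ginc//|b]; rewrite inE => /predU1P[->//|/gf gb i j ij].
by apply: gb; case: ltngtP ij => // [/hinc/ltnW//|->].
Qed.

Lemma increasing_sequence (R : realType) (T : Type) (D : set T) (F : T -> R) x0 : D x0 ->
  (forall x, D x -> exists2 y, D y & F x < F y) ->
  exists2 X : nat -> T, forall i, D (X i) & forall i j, (i < j)%N -> F (X i) < F (X j).
Proof.
move=> Dx0 nomax.
have /choice[next nextP] : forall x, exists y, D x -> D y /\ F x < F y.
  move=> x; have [Dx|Dx] := pselect (D x); last by exists x.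
  by have [y Dy xy] := nomax x Dx; exists y.
pose X i := iter i next x0.
have DX i : D (X i) by elim: i => //= i /nextP[].
exists X => // i j; elim: j => // j IH; rewrite ltnS leq_eqVlt => /predU1P[->|/IH ij].
  by case: (nextP _ (DX j)).
by apply: lt_trans ij _; case: (nextP _ (DX j)).
Qed.

Section Attain.
Variables (R : realType) (K : nonArchLocalFieldType R).
Variable mu : forall k, {measure set (borel 'cV[mtop K]_k) -> \bar R}.
Hypothesis mu_haar : forall k, normalized_haar (mu k).
Variables (n m : nat) (d : 'I_m -> nat) (M : forall j, 'M[K]_(d j, n)) (c : 'I_m -> R).
Hypothesis c0 : forall j, 0 <= c j.
Hypothesis Mfree : forall j, c j != 0 -> row_free (M j).
Local Notation Phi := (lattice_ratio mu M c).
Local Notation vol E := (volume (mu _) E).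

(** The matrices with integral entries form a compact set; by [smith] the
    isometric ones, multiplied by diagonal matrices, reach every lattice. Around
    a matrix that is not isometric a small enough ball contains no isometry. *)
Lemma finite_domination (F : 'M[K]_n -> R) (best : 'M[K]_n -> 'M[K]_n) :
  (forall P0, isometric P0 -> exists2 e : R, 0 < e &
     forall P x, isometric P -> (forall i j, absv ((P - P0) i j) <= e) ->
     diag_mx x \in unitmx -> F (P *m diag_mx x) <= F (P0 *m diag_mx x)) ->
  (forall A U, isometric U -> F (A *m U) = F A) ->
  (forall P, isometric P -> best P \in unitmx) ->
  (forall P x, isometric P -> diag_mx x \in unitmx ->
     F (P *m diag_mx x) <= F (best P)) ->
  exists2 A, A \in unitmx & forall B, B \in unitmx -> F B <= F A.
Proof.
move=> Fnear Fiso bestu bestP.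
pose good P0 A e := forall P x, isometric P -> (forall i j, absv ((P - P0) i j) <= e) ->
  diag_mx x \in unitmx -> F (P *m diag_mx x) <= F A.
have loc P0 : exists Ae : 'M[K]_n * R, [/\ 0 < Ae.2, Ae.1 \in unitmx & good P0 Ae.1 Ae.2].
  have [iP0|nP0] := pselect (isometric P0).
    have [e e0 eP] := Fnear _ iP0.
    exists (best P0, e); split=> //=; first exact: bestu.
    by move=> P x iP Pe xu; apply: le_trans (eP _ _ iP Pe xu) (bestP _ _ iP0 xu).
  exists (1%:M, 2^-1); split=> //=; first exact: unitmx1.
  move=> P x iP Pe _; exfalso; apply: nP0.
  have Pu := isometric_unit iP.
  rewrite (_ : P0 = P *m (1%:M + invmx P *m (P0 - P))); last first.
    by rewrite mulmxDr mulmx1 mulKVmx// subrKC.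
  apply: isometric_mulmx => //; apply: (@isometric_near1 _ _ _ _ 2^-1); first lra.
  move=> i j; suff : polydisc (2^-1 : R) (invmx P *m col j (P0 - P)).
    by move=> /(_ i); rewrite colE mulmxA -colE mxE.
  apply/(isometric_inv iP) => l; have := Pe l j.
  by rewrite !mxE -absvN opprB.
have /choice[Ae AeP] := loc.
pose unvec (y : 'cV[K]_(n * n)) : 'M[K]_n := vec_mx y^T.
have := @compact_polydisc R K (n * n) 1.
rewrite compact_cover => /(_ 'cV[K]_(n * n) setT
  (fun y => [set z | polydisc (Ae (unvec y)).2 (z - y)])).
case=> [y _|x _|D _ cD].
- by have [e0 _ _] := AeP (unvec y); apply: periodic_open e0 _; exact: coset_periodic.
- have [e0 _ _] := AeP (unvec x).
  by exists x => //=; rewrite subrr; exact: polydisc0 (ltW e0).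
have [A Au Amax] : exists2 A, A \in unitmx &
    forall y, y \in enum_fset D -> F (Ae (unvec y)).1 <= F A.
  elim: (enum_fset D) => [|y s [A Au As]]; first by exists 1%:M => //; exact: unitmx1.
  have [yA|Ay] := leP (F (Ae (unvec y)).1) (F A).
    by exists A => // z; rewrite inE => /predU1P[->//|]; exact: As.
  exists (Ae (unvec y)).1 => [|z]; first by case: (AeP (unvec y)).
  by rewrite inE => /predU1P[->//|/As zA]; exact: le_trans zA (ltW Ay).
exists A => // B; have [P [Q [x [iP iQ ->]]]] := smith B.
rewrite !unitmx_mul => /andP[/andP[_ xu] _].
rewrite Fiso//.
have [|y /= yD Py] := cD (mxvec P)^T.
  move=> i; rewrite mxE; case/mxvec_indexP: i => i j; rewrite mxvecE.
  suff : polydisc (1 : R) (P *m delta_mx j 0) by move=> /(_ i); rewrite -colE mxE.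
  by apply/iP => l; rewrite mxE; case: (_ && _); rewrite ?absv0 ?absv1.
apply: le_trans (Amax y yD); have [_ _] := AeP (unvec y); apply=> // i j.
have := Py (mxvec_index i j); rewrite /= !mxE mxvecE; congr (absv (_ - _) <= _).
Qed.

Definition nonzero_entries k (x : 'rV[K]_k) := forall i, x 0 i != 0.

Lemma diag_unit k (x : 'rV[K]_k) : diag_mx x \in unitmx <-> nonzero_entries x.
Proof.
rewrite unitmxE unitfE det_diag; split=> [/prodf_neq0 x0 i|x0]; first exact: x0.
by apply/prodf_neq0 => i _.
Qed.

Definition hadamard k (x y : 'rV[K]_k) : 'rV[K]_k := \row_i (x 0 i * y 0 i).

Lemma diag_hadamard k (x y : 'rV[K]_k) :
  diag_mx (hadamard x y) = diag_mx x *m diag_mx y.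
Proof. by rewrite mulmx_diag; congr diag_mx; apply/rowP => i; rewrite !mxE. Qed.

Lemma det_dsel k l (s : {ffun 'I_k -> 'I_l}) (x : 'rV[K]_l) :
  \det (dsel s x) = \prod_i x 0 (s i).
Proof. by rewrite det_diag; apply: eq_bigr => i _; rewrite mxE. Qed.

Lemma dsel_unit k l (s : {ffun 'I_k -> 'I_l}) (x : 'rV[K]_l) : nonzero_entries x ->
  dsel s x \in unitmx.
Proof. by move=> x0; apply/diag_unit => i; rewrite mxE. Qed.

(** Dickson's lemma speaks of natural numbers: [lev x] counts the powers of the
    uniformizer that are not smaller than [x]. *)
Lemma exists_level : exists lev : K -> nat, forall x y : K, x != 0 -> y != 0 ->
  absv x <= (1 : R) -> absv y <= (1 : R) -> (lev x <= lev y)%N -> absv y <= absv x :> R.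
Proof.
have [p p01 pgap] := uniformizer K; have /andP[p0 p1] := p01.
have ex (x : K) : exists N, (x != 0) ==> (absv p ^+ N < absv x).
  have [->|x0] := eqVneq x 0; first by exists 0.
  have x0' : 0 < absv x :> R by rewrite absv_gt0.
  by have [N] := expr_lt_eventually p01 x0'; exists N; apply/implyP.
exists (fun x => ex_minn (ex x)) => x y x0 y0 x1 y1.
case: ex_minnP => N; rewrite x0/= => Nx _.
case: ex_minnP => N'; rewrite y0/= => N'y N'min NN'.
rewrite leNgt; apply/negP => xy.
have xpy : absv x <= absv p * absv y.
  rewrite -ler_pdivrMr ?absv_gt0// -absvV -absvM; apply: pgap.
  by rewrite absvM absvV ltr_pdivrMr ?absv_gt0// mul1r.
case: N' => [|N'] in N'y N'min NN' *; first by rewrite expr0 ltNge y1 in N'y.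
have yN' : absv y <= absv p ^+ N'.
  by rewrite leNgt; apply/negP => /(N'min N'); rewrite ltnn.
have : absv p ^+ N < absv p ^+ N'.+1.
  by rewrite (lt_le_trans Nx)// (le_trans xpy)// exprS ler_pM2l.
by rewrite ltr_iXn2l// ltnNge NN'.
Qed.

(** Otherwise there is a sequence of diagonal matrices [X i] with strictly
    increasing ratio. Dickson's lemma is applied to the quotients of all minors
    by the dominant one. *)
Lemma exists_best_diag (P : 'M[K]_n) C : P \in unitmx ->
  (forall A, A \in unitmx -> Phi A <= C) ->
  exists2 x, diag_mx x \in unitmx &
    forall y, diag_mx y \in unitmx -> Phi (P *m diag_mx y) <= Phi (P *m diag_mx x).
Proof.
move=> Pu PhiC; apply: contrapT => nomax.
pose B j := M j *m P.
have Bfree j : c j != 0 -> row_free (B j).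
  by move=> cj; apply: row_free_mul_unit => //; exact: Mfree.
have D1 : diag_mx (const_mx 1 : 'rV[K]_n) \in unitmx by rewrite diag_const_mx; exact: unitmx1.
have [x xu|X Xu Xinc] := @increasing_sequence R _ [set x | diag_mx x \in unitmx]
    (fun x => Phi (P *m diag_mx x)) _ D1.
  apply: contrapT => noy; apply: nomax; exists x; first exact: xu.
  move=> y yu; rewrite leNgt; apply/negP => xy; apply: noy; exists y; [exact: yu|exact: xy].
have X0 i k : X i 0 k != 0 by exact: (proj1 (diag_unit _) (Xu i)).
have BXfree i j : c j != 0 -> row_free (B j *m diag_mx (X i)).
  by move=> cj; apply: row_free_mul_unit (Bfree _ cj) (Xu i).
pose T := {dffun forall j : 'I_m, option {ffun 'I_(d j) -> 'I_n}}.
have /choice[s sP] : forall i, exists s : T, forall j, c j != 0 ->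
    exists2 u, s j = Some u & dominant u (B j *m diag_mx (X i)).
  move=> i; pose Q j (t : option {ffun 'I_(d j) -> 'I_n}) :=
    exists2 u, t = Some u & dominant u (B j *m diag_mx (X i)).
  exists (finfun (fun j => xget None (Q j)) : T) => j cj.
  rewrite ffunE; apply: (@xgetPex _ None (Q j)).
  by have [u ud] := exists_dominant (BXfree i j cj); exists (Some u), u.
pose minor i j (t : {ffun 'I_(d j) -> 'I_n}) := \det (colsub t (B j *m diag_mx (X i))).
have [lev levP] := exists_level.
(* The two components indexed by booleans are monotone in opposite senses, so
   that they force [s i = s i']. *)
pose f (a : {j : 'I_m & {ffun 'I_(d j) -> 'I_n}} + bool) i : nat := match a with
  | inl js => if s i (tag js) is Some u
              then lev (minor i (tag js) (tagged js) / minor i (tag js) u) else 0%N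
  | inr true => enum_rank (s i)
  | inr false => (#|T| - enum_rank (s i))%N
  end.
have [i [i' [ii' fii']]] := dickson f.
have sii' : s i = s i'.
  apply: enum_rank_inj; apply/val_inj => /=.
  have rank_eq (N a b : nat) : (a < N)%N -> (b < N)%N -> (a <= b)%N -> (N - a <= N - b)%N ->
    a = b by lia.
  exact: rank_eq (ltn_ord _) (ltn_ord _) (fii' (inr true)) (fii' (inr false)).
(* [Y t] is [X i] moved [t] times in the direction [v], so [Y 1] is [X i']. *)
pose v : 'rV[K]_n := \row_k (X i' 0 k / X i 0 k).
have v0 : nonzero_entries v by move=> k; rewrite mxE mulf_neq0 ?invr_eq0.
pose Y t : 'rV[K]_n := \row_k (X i 0 k * v 0 k ^+ t).
have Y0 t : nonzero_entries (Y t) by move=> k; rewrite mxE mulf_neq0 ?expf_neq0.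
have YS t : Y t.+1 = hadamard (Y t) v.
  by apply/rowP => k; rewrite !mxE exprSr mulrA.
have Yi : Y 0%N = X i by apply/rowP => k; rewrite !mxE mulr1.
have Yi' : Y 1%N = X i' by apply/rowP => k; rewrite !mxE expr1 mulrC divfK.
have minorE t j (u : {ffun 'I_(d j) -> 'I_n}) :
    \det (colsub u (B j *m diag_mx (Y t))) =
    minor i j u * (\prod_k v 0 (u k)) ^+ t.
  elim: t => [|t IH]; first by rewrite expr0 mulr1 Yi.
  by rewrite YS diag_hadamard mulmxA colsub_diag det_mulmx IH det_dsel exprSr mulrA.
(* From [X i] to [X i'] the minor [u'] loses ground against the dominant minor
   [u]; that loss is the same at each step in the direction [v]. *)
have Ydom t j u : c j != 0 -> s i j = Some u -> dominant u (B j *m diag_mx (Y t)).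
  move=> cj siu.
  have [uu udom] : dominant u (B j *m diag_mx (X i)).
    by have [u' + ?] := sP i j cj; rewrite siu => -[->].
  have [uu' udom'] : dominant u (B j *m diag_mx (X i')).
    by have [u' + ?] := sP i' j cj; rewrite -sii' siu => -[->].
  have mu0 : minor i j u != 0 by rewrite -unitfE -unitmxE.
  have Vu0 : \prod_k v 0 (u k) != 0 by apply/prodf_neq0 => k _.
  split=> [|u'].
    by rewrite unitmxE unitfE minorE mulf_neq0// expf_neq0.
  rewrite !minorE !absvM !absvX.
  have [mu'0|mu'0] := eqVneq (minor i j u') 0.
    by rewrite mu'0 absv0 mul0r mulr_ge0 ?exprn_ge0 ?absv_ge0.
  apply: ler_pM; rewrite ?exprn_ge0 ?absv_ge0//; first exact: udom.
  apply: lerXn2r; rewrite ?nnegrE ?absv_ge0//.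
  have Vu'0 : \prod_k v 0 (u' k) != 0 by apply/prodf_neq0 => k _.
  have minor' w : minor i' j w = minor i j w * \prod_k v 0 (w k).
    by rewrite /minor -Yi' minorE expr1.
  have nrm (w z : K) : z != 0 -> absv w <= absv z :> R -> absv (w / z) <= (1 : R).
    by move=> z0 wz; rewrite absvM absvV ler_pdivrMr ?absv_gt0// mul1r.
  have mu'1 : minor i' j u != 0 by rewrite minor' mulf_neq0.
  have : absv (minor i' j u' / minor i' j u) <= absv (minor i j u' / minor i j u) :> R.
    apply: levP.
    - by rewrite mulf_neq0 ?invr_eq0.
    - by rewrite mulf_neq0 ?invr_eq0// minor' mulf_neq0.
    - by apply: nrm => //; exact: udom.
    - by apply: nrm => //; exact: udom'.
    - by have := fii' (inl (Tagged _ u')); rewrite /f /= -sii' siu.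
  rewrite !minor'.
  rewrite !absvM !absvV !absvM => H.
  have [a0 b0 a'0 b'0] : [/\ 0 < absv (minor i j u) :> R, 0 < absv (\prod_k v 0 (u k)) :> R,
    0 < absv (minor i j u') :> R & 0 < absv (\prod_k v 0 (u' k)) :> R] by rewrite !absv_gt0.
  move: H a0 b0 a'0 b'0; set a : R := absv (minor i j u); set b : R := absv (\prod_k v 0 (u k)).
  set a' : R := absv (minor i j u'); set b' : R := absv (\prod_k v 0 (u' k)).
  move=> H a0 b0 a'0 b'0; rewrite -subr_ge0.
  have -> : b - b' = (a' / a - a' * b' / (a * b)) * (a / a' * b).
    by field; rewrite !gt_eqF.
  by apply: mulr_ge0; [rewrite subr_ge0|rewrite mulr_ge0 ?divr_ge0 ?ltW].
pose selvol j x := if s i j is Some u then vol (lattice (dsel u x)) else 1.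
(* As long as the dominant columns do not change, a step in the direction [v]
   multiplies every volume by a constant. *)
pose rho := vol (lattice (diag_mx v)) / \prod_(j < m) selvol j v `^ c j.
have vu : diag_mx v \in unitmx by exact/diag_unit.
have PhiS t : Phi (P *m diag_mx (Y t.+1)) = Phi (P *m diag_mx (Y t)) * rho.
  have YSu := proj2 (diag_unit _) (Y0 t.+1); have Yu := proj2 (diag_unit _) (Y0 t).
  rewrite !lattice_ratioE /rho mulrACA -invfM -big_split/=; congr (_ / _).
    by rewrite YS diag_hadamard mulmxA vol_lattice_mulmx// unitmx_mul Pu.
  apply: eq_bigr => j _; have [->|cj] := eqVneq (c j) 0; first by rewrite !powRr0 mulr1.
  have [u su _] := sP i j cj.
  have E t' : vol (lattice (M j *m (P *m diag_mx (Y t')))) =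
      vol (lattice (colsub u (B j *m diag_mx (Y t')))).
    by rewrite mulmxA (lattice_dominant (Ydom t' j u cj su)).
  rewrite /selvol su !E -powRM ?vol_ge0//; congr (_ `^ _).
  rewrite {1}YS diag_hadamard mulmxA colsub_diag vol_lattice_mulmx//.
  - by case: (Ydom t j u cj su).
  - exact: dsel_unit.
have Phi0 : 0 < Phi (P *m diag_mx (X i)).
  by apply: lattice_ratio_gt0 => //; rewrite unitmx_mul Pu Xu.
have rho1 : 1 < rho.
  by have := Xinc _ _ ii'; rewrite -Yi -Yi' PhiS Yi ltr_pMr.
have PhiX t : Phi (P *m diag_mx (Y t)) = Phi (P *m diag_mx (X i)) * rho ^+ t.
  elim: t => [|t IH]; first by rewrite Yi expr0 mulr1.
  by rewrite PhiS IH exprSr mulrA.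
have C0 : 0 < C by apply: lt_le_trans Phi0 (PhiC _ _); rewrite unitmx_mul Pu Xu.
have rho01 : 0 < rho^-1 < 1 by rewrite invr_gt0 invf_lt1 (lt_trans ltr01 rho1)/=.
have [N] := expr_lt_eventually rho01 (divr_gt0 Phi0 C0).
rewrite ltr_pdivlMr// exprVn ltr_pdivrMl ?exprn_gt0 ?(lt_trans ltr01)//.
apply/negP; rewrite -leNgt mulrC -PhiX; apply: PhiC.
by rewrite unitmx_mul Pu; exact/diag_unit.
Qed.

(** [exists_best_diag] provides the optimum for each isometric factor, and
    [finite_domination] reduces to finitely many of them. *)
Theorem exists_best_lattice C : (forall A, A \in unitmx -> Phi A <= C) ->
  exists2 A, A \in unitmx & forall B, B \in unitmx -> Phi B <= Phi A.
Proof.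
move=> PhiC.
have /choice[best bestP] : forall P, exists A : 'M[K]_n, isometric P ->
    A \in unitmx /\ forall x, diag_mx x \in unitmx -> Phi (P *m diag_mx x) <= Phi A.
  move=> P; have [iP|] := pselect (isometric P); last by exists P.
  have Pu := isometric_unit iP; have [x xu xmax] := exists_best_diag Pu PhiC.
  by exists (P *m diag_mx x) => _; rewrite unitmx_mul Pu; split.
apply: (@finite_domination Phi best).
- by move=> P0; exact: dominated_near.
- by move=> A U; exact: lattice_ratio_isometric.
- by move=> P /bestP[].
- by move=> P x /bestP[_ bP] xu; exact: bP.
Qed.

End Attain.

(** * From Schwartz-Bruhat tuples to lattices *)

Section BrascampLiebData.
Variables (R : realType) (K : nonArchLocalFieldType R).
Variable mu : forall k, {measure set (borel 'cV[mtop K]_k) -> \bar R}.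
Hypothesis mu_haar : forall k, normalized_haar (mu k).
Variables (n m : nat) (d : 'I_m -> nat).
Variables (L : forall j, {linear 'cV[K]_n -> 'cV[K]_(d j)}) (c : 'I_m -> R).
Variable M : forall j, 'M[K]_(d j, n).
Hypothesis LM : forall j x, L j x = M j *m x.
Hypothesis c0 : forall j, 0 <= c j.
Hypothesis kerL : forall x : 'cV[K]_n, (forall j, c j != 0 -> M j *m x = 0) -> x = 0.
Local Notation vol E := (volume (mu _) E).

(** The rows of the [M j] with [c j != 0] span all row vectors, so the identity
    is a combination of these [M j]. *)
Lemma kernel_bound : exists2 C : R, 1 <= C & forall r x, 0 <= r ->
  (forall j, c j != 0 -> polydisc r (M j *m x)) -> polydisc (C * r) x.
Proof.
pose S := (\sum_(j | c j != 0) genmx (M j))%MS.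
have MS j : c j != 0 -> M j *m cokermx S = 0.
  move=> cj; have : (M j <= S)%MS by apply: (sumsmx_sup j) => //; rewrite genmxE.
  by rewrite submxE => /eqP.
have S1 : (1%:M <= S)%MS.
  rewrite submxE mul1mx; apply/eqP/matrixP => a b.
  have : col b (cokermx S) = 0 by apply: kerL => j cj; rewrite colE mulmxA MS ?mul0mx.
  by move/colP/(_ a); rewrite !mxE.
have /sub_sumsmxP[u uS] := S1.
have wM j : exists w, (genmx (M j))%MS = w *m M j by apply/submxP; rewrite genmxE.
pose w j := projT1 (cid (wM j)); have wE j := projT2 (cid (wM j)) : (genmx (M j))%MS = w j *m M j.
have [C' C'1 C'max] := mx_family_bound (fun j => u j *m w j).
exists C' => // r x r0 xr; have C'0 : 0 <= C' by apply: le_trans C'1.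
have -> : x = \sum_(j | c j != 0) (u j *m w j) *m (M j *m x).
  rewrite -{1}[x]mul1mx uS mulmx_suml; apply: eq_bigr => j _.
  by rewrite wE -!mulmxA.
have := mulr_ge0 C'0 r0; elim/big_ind : _ => [|y z yr zr r'0|j cj r'0].
- exact: polydisc0.
- by apply: polydiscD; [exact: yr|exact: zr].
by apply: polydisc_mulmx => //; exact: xr.
Qed.

Lemma BL_atE (f : forall j, 'cV[K]_(d j) -> R) (a : R) (b : 'I_m -> R) :
  (\int[mu n]_x (\prod_(j < m) (f j (L j x) `^ c j)%R)%:E)%E = a%:E ->
  (forall j, c j != 0 -> (\int[mu (d j)]_x (f j x)%:E)%E = (b j)%:E /\ 0 < b j) ->
  BL_at mu L c f = (a / \prod_(j < m) b j `^ c j)%:E.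
Proof.
move=> fa fb; rewrite /BL_at fa.
have -> : (\prod_(j < m) (\int[mu (d j)]_x (f j x)%:E) `^ c j)%E =
    (\prod_(j < m) b j `^ c j)%:E.
  rewrite -prodEFin; apply: eq_bigr => j _.
  have [->|cj] := eqVneq (c j) 0; first by rewrite poweRe0 powRr0.
  by have [-> _] := fb j cj; rewrite poweR_EFin.
rewrite inver gt_eqF -?EFinM//; apply: prodr_gt0 => j _.
have [->|cj] := eqVneq (c j) 0; first by rewrite powRr0.
by rewrite powR_gt0//; have [] := fb j cj.
Qed.

(** Pass to finite quotients and apply [finite_brascamp_lieb]. The subgroups it
    yields are stable under multiplication by units, and their preimages in the
    polydiscs are therefore modules over the ring of integers. *)
Lemma BL_at_le_modules (f : forall j, 'cV[K]_(d j) -> R) :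
  (forall j, nonneg_nonzero_sb (f j)) ->
  exists (M0 : set 'cV[K]_n) (N : forall j, set 'cV[K]_(d j)),
  [/\ compact_open M0 /\ omodule M0,
      forall j, compact_open (N j) /\ N j 0,
      forall j x, c j != 0 -> M0 x -> N j (M j *m x) &
      (BL_at mu L c f <= (vol M0 / \prod_(j < m) vol (N j) `^ c j)%:E)%E].
Proof.
move=> fsb.
have f0 j x : 0 <= f j x by case: (fsb j).
have /choice[h' /choice[r' hrP]] : forall j, exists h r, 0 < h /\ scaled h r (f j).
  by move=> j; have [/schwartz_bruhat_scaled[h [r [h0 fs]]] _ _] := fsb j; exists h, r.
have [h h0 hle] := finite_lower_bound (fun j => proj1 (hrP j)).
have [r1 r11 rle] := finite_upper_bound r'.
have [CK CK1 CKP] := kernel_bound.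
have [C C1 MC] := mx_family_bound M.
have C0 : 0 < C by apply: lt_le_trans C1.
(* Scales: [M j] maps the polydisc of radius [hn] into that of radius [h] and
   the polydisc of radius [rn] into that of radius [r], and the integrand is
   supported in the polydisc of radius [rn]. *)
pose hn := h / C; pose rn := Num.max (CK * r1) hn; pose r := Num.max r1 (Num.max h (C * rn)).
have hn0 : 0 < hn by rewrite divr_gt0.
have hnrn : hn <= rn by rewrite le_max lexx orbT.
have rn0 : 0 <= rn by rewrite (le_trans (ltW hn0)).
have hr : h <= r by rewrite !le_max lexx !orbT.
have r0 : 0 <= r by rewrite (le_trans (ltW h0)).
have Mhn j x : polydisc hn x -> polydisc h (M j *m x).
  move=> xh; rewrite -[h](divfK (lt0r_neq0 C0)) mulrC.
  by apply: polydisc_mulmx => //; exact: ltW.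
have Mrn j x : polydisc rn x -> polydisc r (M j *m x).
  move=> xr; apply: (@le_polydisc _ _ _ (C * rn)); first by rewrite !le_max lexx !orbT.
  by apply: polydisc_mulmx => //; exact: ltW.
have fs j : scaled h r (f j).
  have [_ fs'] := hrP j; apply: scaled_le fs'; first exact: hle.
  by rewrite le_max rle.
pose F x := \prod_(j < m) (f j (L j x) `^ c j)%R.
have F0 x : 0 <= F x by apply: prodr_ge0 => j _; exact: powR_ge0.
have Fs : scaled hn rn F.
  split=> [x Fx|x y yh]; last first.
    by apply: eq_bigr => j _; rewrite !LM mulmxDr (proj2 (fs j))//; exact: Mhn.
  apply: (@le_polydisc _ _ _ (CK * r1)); first by rewrite le_max lexx.
  apply: CKP => [|j cj]; first by rewrite (le_trans _ r11).
  apply: le_polydisc (rle j) _ _; have [_ [fr _]] := hrP j; apply: fr.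
  apply/negP => /eqP fj0; move/negP: Fx; apply; rewrite /F (bigD1 j)//= LM fj0.
  by rewrite powR0// mul0r.
pose G := polydisc_quotientP K n hn0 hnrn.
pose H j := polydisc_quotientP K (d j) h0 hr.
pose phi0 j (q : G) : H j := pq_proj (H j) (M j *m pq_rep q).
have phi0_proj j x : polydisc rn x -> phi0 j (pq_proj G x) = pq_proj (H j) (M j *m x).
  move=> xr; apply/(pq_proj_eq (H j)); [apply: Mrn; exact: pq_rep_polydisc|exact: Mrn|].
  by rewrite -mulmxBr; apply: Mhn; exact: pq_rep_proj.
have phi_ex j : exists g : {additive G -> H j}, forall x, g x = phi0 j x.
  apply: exists_additive => p q; have [pr qr] := (pq_rep_polydisc p, pq_rep_polydisc q).
  rewrite -{1}[p]pq_repK -{1}[q]pq_repK -pq_projB// phi0_proj; last exact: polydiscB.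
  by rewrite mulmxBr pq_projB//; exact: Mrn.
pose phi j := projT1 (cid (phi_ex j)).
have phiE j q : phi j q = phi0 j q := projT2 (cid (phi_ex j)) q.
have [T [T0 TD TS TBL]] := finite_brascamp_lieb phi c0.
pose N j : set 'cV[K]_(d j) := [set y | polydisc r y /\ pq_proj (H j) y \in T j].
pose M0 : set 'cV[K]_n := [set x | polydisc rn x /\
  forall j, c j != 0 -> pq_proj (H j) (M j *m x) \in T j].
have Nh j : periodic h (N j).
  move=> y z [yr yT] zh; have yzr : polydisc r (y + z).
    by apply: polydiscD => //; exact: le_polydisc zh.
  split=> //; rewrite (_ : pq_proj _ _ = pq_proj (H j) y)//.
  by apply/(pq_proj_eq (H j)) => //; rewrite addrAC subrr add0r.
have M0h : periodic hn M0.
  move=> y z [yr yT] zh; have yzr : polydisc rn (y + z).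
    by apply: polydiscD => //; exact: le_polydisc zh.
  split=> // j cj; rewrite -phi0_proj// (_ : pq_proj G _ = pq_proj G y).
    by rewrite phi0_proj//; exact: yT.
  by apply/(pq_proj_eq G) => //; rewrite addrAC subrr add0r.
have Nr j : N j `<=` polydisc r by move=> y [].
have M0r : M0 `<=` polydisc rn by move=> y [].
have VG0 : 0 < vol (polydisc hn : set 'cV[K]_n).
  by apply: vol_gt0 => //; [exact: polydisc_compact_open|exists 0; exact/polydisc0/ltW].
have VH0 j : 0 < vol (polydisc h : set 'cV[K]_(d j)).
  by apply: vol_gt0 => //; [exact: polydisc_compact_open|exists 0; exact/polydisc0/ltW].
exists M0, N; split.
- split; first by exists hn, rn.
  apply: omodule_units => [|x y [xr xT] [yr yT]|a x a1 [xr xT]].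
  + by split=> [|j cj]; [exact: polydisc0|rewrite mulmx0 pq_proj0//; exact: T0].
  + split=> [|j cj]; first exact: polydiscD.
    by rewrite mulmxDr pq_projD; [apply: TD; [exact: xT|exact: yT]|exact: Mrn|exact: Mrn].
  + split=> [|j cj]; first by apply: polydiscZ; rewrite ?a1.
    have [al alinj alE] := quotient_scale G hnrn a1.
    have psi_ex i := quotient_scale (H i) hr a1.
    pose psi i := projT1 (cid2 (psi_ex i)).
    have psiinj i : injective (psi i) by rewrite /psi; case: cid2.
    have psiE i y : polydisc r y -> psi i (pq_proj (H i) y) = pq_proj (H i) (a *: y).
      by rewrite /psi; case: cid2 => g /= _; exact.
    have compat : compatible phi al psi.
      split=> // i q; have qr := pq_rep_polydisc q.
      rewrite -{1}[q]pq_repK alE// !phiE phi0_proj; last by apply: polydiscZ; rewrite ?a1.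
      by rewrite -scalemxAr -psiE//; exact: Mrn.
    rewrite -scalemxAr -psiE; last exact: Mrn.
    by apply: (TS _ _ compat); exact: xT.
- move=> j; split; first by exists h, r.
  by split; [exact: polydisc0|rewrite pq_proj0//; exact: T0].
- by move=> j x cj [xr xT]; split; [exact: Mrn|exact: xT].
pose fbar (i : {j : 'I_m & H j}) : R := f (tag i) (pq_rep (tagged i)).
have fbar0 i : 0 <= fbar i by exact: f0.
have mass_gt0 j : 0 < mass fbar j.
  have [_ _ [x fx]] := fsb j; have xr := proj1 (fs j) x fx.
  rewrite /mass (bigD1 (pq_proj (H j) x))//= ltr_pwDl ?sumr_ge0//.
  rewrite /fbar /= -(subrKC x (pq_rep _)) (proj2 (fs j)); last exact: pq_rep_proj.
  by rewrite lt_neqAle eq_sym fx f0.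
rewrite (@BL_atE _ (vol (polydisc hn : set 'cV[K]_n) * multiform phi c fbar)
  (fun j => vol (polydisc h : set 'cV[K]_(d j)) * mass fbar j)); first last.
- move=> j _; split; last by rewrite mulr_gt0.
  by rewrite (integral_quotient (mu_haar (d j)) (H j) h0 hr (fs j))//.
- rewrite (integral_quotient (mu_haar n) G hn0 hnrn Fs)//; congr (_ * _)%:E.
  apply: eq_bigr => q _; apply: eq_bigr => j _.
  have qr := Mrn j _ (pq_rep_polydisc q).
  rewrite /fbar /= phiE ger0_norm// LM; congr (_ `^ _).
  by rewrite -[in RHS](subrKC (M j *m pq_rep q) (pq_rep _)) (proj2 (fs j))//; exact: pq_rep_proj.
rewrite lee_fin (vol_quotient (mu_haar n) G hn0 hnrn M0h M0r) -!mulrA ler_pM2l//.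
have -> : \sum_(q : G) (\1_M0 (pq_rep q) : R) =
    #|[set q : G | [forall j, (c j != 0) ==> (phi j q \in T j)]]%SET|%:R.
  rewrite -sum1_card natr_sum [RHS]big_mkcond; apply: eq_bigr => q _.
  rewrite indicE inE; case: ifPn => [/forallP qT|/forallPn[j]].
    rewrite mem_set//; split=> [|j cj]; first exact: pq_rep_polydisc.
    by have := qT j; rewrite cj phiE.
  rewrite negb_imply phiE => /andP[cj qT]; rewrite memNset// => -[_ /(_ j cj)].
  exact/negP.
have VN j : vol (N j) = vol (polydisc h : set 'cV[K]_(d j)) * #|T j|%:R.
  rewrite (vol_quotient (mu_haar (d j)) (H j) h0 hr (Nh j) (Nr j)); congr (_ * _).
  rewrite -sum1_card natr_sum [RHS]big_mkcond; apply: eq_bigr => q _.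
  rewrite indicE; case: ifPn => qT.
    by rewrite mem_set//; split; [exact: pq_rep_polydisc|rewrite pq_repK].
  by rewrite memNset// => -[_]; rewrite pq_repK; exact/negP.
under eq_bigr do rewrite powRM ?(ltW (VH0 _)) ?(ltW (mass_gt0 _))//.
under [in leRHS]eq_bigr do rewrite VN powRM ?(ltW (VH0 _)) ?ler0n//.
rewrite !big_split/=.
have pos (b : 'I_m -> R) : (forall j, 0 < b j) -> 0 < \prod_(j < m) b j `^ c j.
  by move=> b0; apply: prodr_gt0 => j _; rewrite powR_gt0.
have VHp := pos _ VH0; have mp := pos _ mass_gt0.
have Tp : 0 < \prod_(j < m) #|T j|%:R `^ c j :> R.
  by apply: pos => j; rewrite ltr0n; apply/card_gt0P; exists 0; exact: T0.
rewrite ler_pdivrMr ?mulr_gt0//; apply: le_trans (TBL _ fbar0) _.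
rewrite le_eqVlt; apply/orP; left; apply/eqP; field.
by rewrite !gt_eqF.
Qed.

(** * Indicator tuples and the conclusion *)

Definition common_preimage (E : forall j, set 'cV[K]_(d j)) : set 'cV[K]_n :=
  [set x | forall j, c j != 0 -> E j (M j *m x)].

Lemma common_preimage_compact_open E : (forall j, c j != 0 -> compact_open (E j)) ->
  compact_open (common_preimage E).
Proof.
move=> cE.
have /choice[h /choice[r hrP]] : forall j, exists h r, 0 < h /\
    (c j != 0 -> periodic h (E j) /\ E j `<=` polydisc r).
  move=> j; have [cj|cj] := eqVneq (c j) 0; first by exists 1, 1.
  by have [h [r [h0 Eh Er]]] := cE j cj; exists h, r.
have [h' h'0 h'h] := finite_lower_bound (fun j => proj1 (hrP j)).
have [r' r'1 rr'] := finite_upper_bound r.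
have [CK CK1 CKP] := kernel_bound.
have [C C1 MC] := mx_family_bound M.
have C0 : 0 < C by apply: lt_le_trans C1.
exists (h' / C), (CK * r'); split; first by rewrite divr_gt0.
  move=> x y xE yh j cj; have [_ /(_ cj)[Eh _]] := hrP j.
  rewrite mulmxDr; apply: Eh; first exact: xE.
  apply: (le_polydisc (h'h j)); rewrite -[h'](divfK (lt0r_neq0 C0)) mulrC.
  by apply: polydisc_mulmx => //; rewrite ?divr_ge0 ?ltW.
move=> x xE; apply: CKP => [|j cj]; first by rewrite (le_trans _ r'1).
by apply: le_polydisc (rr' j) _ _; have [_ /(_ cj)[_]] := hrP j; apply; exact: xE.
Qed.

Lemma BL_at_indic E : (forall j, c j != 0 -> compact_open (E j) /\ E j !=set0) ->
  BL_at mu L c (fun j => \1_(E j)) =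
  (vol (common_preimage E) / \prod_(j < m) vol (E j) `^ c j)%:E.
Proof.
move=> EP; have cE := common_preimage_compact_open (fun j cj => proj1 (EP j cj)).
apply: BL_atE => [|j cj].
  rewrite -(volE (mu_haar n) cE).
  transitivity (\int[mu n]_x (\1_(common_preimage E) x)%:E)%E; last first.
    by rewrite integral_indic ?setIT//; exact: compact_open_measurable.
  apply: eq_integral => x _; congr (_%:E); rewrite indicE.
  have [xE|xE] := pselect (common_preimage E x).
    rewrite mem_set// big1// => j _; rewrite indicE LM.
    have [->|cj] := eqVneq (c j) 0; first by rewrite powRr0.
    by rewrite mem_set ?powR1//; exact: xE.
  rewrite memNset//; have /existsNP[j /not_implyP[cj nE]] := xE.
  by rewrite (bigD1 j)//= indicE LM memNset// powR0// mul0r.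
have [cEj Ej0] := EP j cj; split; last exact: vol_gt0.
rewrite -(volE (mu_haar (d j)) cEj) integral_indic ?setIT//.
exact: compact_open_measurable.
Qed.

Lemma le_BL f : (forall j, nonneg_nonzero_sb (f j)) -> (BL_at mu L c f <= BL mu L c)%E.
Proof. by move=> fsb; apply: ereal_sup_ubound; exists f. Qed.

(** A component with [c j = 0] enters [BL_at] only through zeroth powers, so it
    can be replaced by the indicator of the unit polydisc. *)
Lemma exists_sb_indic E : (forall j, c j != 0 -> compact_open (E j) /\ E j !=set0) ->
  exists2 f : forall j, 'cV[K]_(d j) -> R, (forall j, nonneg_nonzero_sb (f j)) &
    BL_at mu L c f = BL_at mu L c (fun j => \1_(E j)).
Proof.
move=> EP; pose E' j : set 'cV[K]_(d j) := if c j == 0 then polydisc 1 else E j.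
have E'P j : compact_open (E' j) /\ E' j !=set0.
  rewrite /E'; case: eqVneq => [_|/EP//]; split; first exact: polydisc_compact_open.
  by exists 0; exact: polydisc0.
exists (fun j => \1_(E' j)) => [j|].
  by have [? ?] := E'P j; exact: indic_nonneg_nonzero_sb.
rewrite !BL_at_indic => [|//|j _]; last exact: E'P.
congr (_ / _)%:E.
  congr volume; apply/seteqP; split=> x xE j cj; have := xE j cj;
  by rewrite /E' (negbTE cj).
apply: eq_bigr => j _; rewrite /E'.
by have [->|//] := eqVneq (c j) 0; rewrite !powRr0.
Qed.

Lemma BL_at_indic_le_BL E : (forall j, c j != 0 -> compact_open (E j) /\ E j !=set0) ->
  ((vol (common_preimage E) / \prod_(j < m) vol (E j) `^ c j)%:E <= BL mu L c)%E.
Proof.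
by move=> EP; rewrite -BL_at_indic//; have [f fsb <-] := exists_sb_indic EP; exact: le_BL.
Qed.

(** If [M j] is not onto, its image lies in a hyperplane. The lattices [X N] thin
    out towards that hyperplane and contain [lattice (M j)]; their volumes
    decrease geometrically, while the integral stays at least 1. *)
Lemma BL_fin_row_free : (BL mu L c < +oo)%E -> forall j, c j != 0 -> row_free (M j).
Proof.
move=> BLfin j cj; apply: contrapT => nfree.
have rk : (\rank (M j) < d j)%N.
  by rewrite ltn_neqAle rank_leq_row andbT; exact/negP.
(* After multiplication by [A] the row [i0] of [M j] is zero: [i0] is the first
   row beyond the rank. *)
pose i0 := Ordinal rk; pose A := invmx (col_ebase (M j)).
have Au : A \in unitmx by rewrite unitmx_inv col_ebase_unit.
have AM0 l : (A *m M j) i0 l = 0.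
  rewrite -{1}[M j]mulmx_ebase /A !mulmxA mulVmx ?col_ebase_unit// mul1mx mxE big1// => a _.
  by rewrite mxE /= ltnn andbF mul0r.
have [C C1 AMC] := mx_bound (A *m M j); have [g g0 Cg] := large_element K C.
have [p /andP[p0 p1] _] := uniformizer K.
pose x N : 'rV[K]_(d j) := \row_i (if i == i0 then p ^+ N else g).
pose y : 'rV[K]_(d j) := \row_i (if i == i0 then p else 1).
have pn0 : p != 0 by rewrite -(@absv_gt0 R).
have xu N : diag_mx (x N) \in unitmx.
  by apply/diag_unit => i; rewrite mxE; case: ifP => // _; rewrite expf_neq0.
have yu : diag_mx y \in unitmx.
  by apply/diag_unit => i; rewrite mxE; case: ifP => // _; rewrite oner_eq0.
have xS N : diag_mx (x N.+1) = diag_mx (x N) *m diag_mx y.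
  rewrite -diag_hadamard; congr diag_mx; apply/rowP => i; rewrite !mxE.
  by case: ifP; rewrite ?exprSr ?mulr1.
pose delta := vol (lattice (diag_mx y)).
have delta0 : 0 < delta by exact: vol_lattice_gt0.
have delta1 : delta < 1.
  rewrite -(vol_polydisc1 (mu_haar (d j))).
  apply: (@lt_vol _ _ _ _ (mu_haar (d j)) _ _ (delta_mx i0 0)) => //.
  - exact: lattice_compact_open.
  - exact: polydisc_compact_open.
  - move=> _ [z z1 <-] i; rewrite mul_diag_mx !mxE absvM (le_trans _ (z1 i))//.
    by rewrite ler_piMl ?absv_ge0//; case: ifP; rewrite ?absv1// ltW.
  - by move=> i; rewrite mxE; case: (_ && _); rewrite ?absv0 ?absv1.
  move=> [z z1] /matrixP/(_ i0 0); rewrite mul_diag_mx !mxE !eqxx /= => pz.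
  have : absv (p * z i0 0) < (1 : R).
    rewrite absvM (le_lt_trans _ p1)// ler_piMr ?absv_ge0//; exact: z1.
  by rewrite pz absv1 ltxx.
pose X N := lattice (invmx A *m diag_mx (x N)).
have Xvol N : vol (X N) = vol (X 0%N) * delta ^+ N.
  elim: N => [|N IH]; first by rewrite expr0 mulr1.
  have uN : invmx A *m diag_mx (x N) \in unitmx by rewrite unitmx_mul unitmx_inv Au xu.
  by rewrite /X xS mulmxA (vol_lattice_mulmx mu_haar uN yu) -/(X N) IH exprSr mulrA.
have Xco N : compact_open (X N).
  by apply: lattice_compact_open; rewrite unitmx_mul unitmx_inv Au xu.
have MX N : lattice (M j) `<=` X N.
  move=> _ [z z1 <-]; pose w : 'cV[K]_(d j) := \col_i (if i == i0 then 0 else (A *m M j *m z) i 0 / g).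
  exists w.
    move=> i; rewrite mxE; case: ifP => [_|_]; first by rewrite absv0.
    rewrite absvM absvV ler_pdivrMr ?absv_gt0// mul1r (le_trans _ Cg)//.
    rewrite -[C]mulr1; apply: polydisc_mulmx => //; exact: le_trans C1.
  have -> : invmx A *m diag_mx (x N) *m w = invmx A *m (A *m M j *m z).
    rewrite -mulmxA; congr (_ *m _); apply/matrixP => i k; rewrite ord1 mul_diag_mx !mxE.
    case: eqVneq => [->|_]; last by rewrite mulrC divfK//; apply: eq_bigr.
    by rewrite mulr0 big1// => l _; rewrite AM0 mul0r.
  by rewrite !mulmxA mulVmx// mul1mx.
have Eex i : exists E : nat -> set 'cV[K]_(d i), exists v : R,
    [/\ forall N, compact_open (E N), forall N, lattice (M i) `<=` E N, 0 < v &
     forall N, vol (E N) = v * (if i == j then delta else 1) ^+ N].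
  have [->|ij] := eqVneq i j.
    exists X, (vol (X 0%N)); split=> //; apply: vol_gt0 => //; exact: lattice_neq0.
  have [Ci Ci1 MCi] := mx_bound (M i); have Ci0 : 0 < Ci by apply: lt_le_trans Ci1.
  have cP := @polydisc_compact_open R K (d i) Ci Ci0.
  exists (fun=> polydisc Ci), (vol (polydisc Ci : set 'cV[K]_(d i))); split=> //.
  - move=> _ _ [z z1 <-]; rewrite -[Ci]mulr1; apply: polydisc_mulmx => //; exact: ltW.
  - by apply: vol_gt0 => //; exists 0; exact/polydisc0/ltW.
  - by move=> N; rewrite expr1n mulr1.
pose E N i := projT1 (cid (Eex i)) N.
have /choice[v vP] : forall i, exists v : R,
    [/\ forall N, compact_open (E N i), forall N, lattice (M i) `<=` E N i, 0 < v &
     forall N, vol (E N i) = v * (if i == j then delta else 1) ^+ N].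
  by move=> i; rewrite /E; case: cid.
pose V := \prod_(i < m) v i `^ c i.
have V0 : 0 < V.
  by apply: prodr_gt0 => i _; rewrite powR_gt0//; case: (vP i).
have volE N : \prod_(i < m) vol (E N i) `^ c i = V * (delta `^ c j) ^+ N.
  have -> : \prod_(i < m) vol (E N i) `^ c i =
      \prod_(i < m) (v i `^ c i * ((if i == j then delta else 1) ^+ N) `^ c i).
    apply: eq_bigr => i _; have [_ _ v0 ->] := vP i; rewrite powRM ?ltW//.
    by rewrite exprn_gt0//; case: ifP.
  rewrite big_split/=; congr (_ * _); rewrite (bigD1 j)//= eqxx big1 ?mulr1; last first.
    by move=> i /negbTE ->; rewrite expr1n powR1.
  exact: powR_expr (ltW delta0).
have bound N : ((V * (delta `^ c j) ^+ N)^-1%:E <= BL mu L c)%E.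
  have EP i : c i != 0 -> compact_open (E N i) /\ E N i !=set0.
    have [cE ME _ _] := vP i => _; split=> //.
    by exists 0; apply: ME; exists 0; [exact: polydisc0|rewrite mulmx0].
  apply: le_trans (BL_at_indic_le_BL EP); rewrite lee_fin volE -[leLHS]mul1r.
  rewrite ler_wpM2r ?invr_ge0 ?mulr_ge0 ?exprn_ge0 ?powR_ge0 ?(ltW V0)//.
  rewrite -(vol_polydisc1 (mu_haar n)); apply: le_vol => //.
  - exact: polydisc_compact_open.
  - by apply: common_preimage_compact_open => i /EP[].
  - by move=> z z1 i _; have [_ ME _ _] := vP i; apply: ME; exists z.
have e01 : 0 < delta `^ c j < 1.
  rewrite powR_gt0//=; suff : delta `^ c j < 1 `^ c j by rewrite powR1.
  apply: gt0_ltr_powR; rewrite ?nnegrE ?(ltW delta0)//.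
  by rewrite lt_neqAle eq_sym cj c0.
have pos N : 0 < V * delta `^ c j ^+ N.
  by rewrite mulr_gt0// exprn_gt0//; case/andP: e01.
have BLfn : BL mu L c \is a fin_num.
  rewrite ge0_fin_numE//; apply: le_trans (bound 0%N).
  by rewrite lee_fin invr_ge0 ltW.
have B0 : 0 < fine (BL mu L c).
  by rewrite -lte_fin fineK//; apply: lt_le_trans (bound 0%N); rewrite lte_fin invr_gt0.
have VB0 : 0 < (V * fine (BL mu L c))^-1 by rewrite invr_gt0 mulr_gt0.
have [N0] := expr_lt_eventually e01 VB0.
have := bound N0; rewrite -[in X in X -> _](fineK BLfn) lee_fin.
rewrite -[leLHS]mul1r ler_pdivrMr// -[X in _ < X]mul1r ltr_pdivlMr ?mulr_gt0// => H.
by rewrite mulrCA mulrA mulrC ltNge H.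
Qed.

(** [BL_at_le_modules] and [lattice_basis] bound [BL] by the supremum of
    [lattice_ratio], which is attained and bounded by the value of [BL_at] at the
    corresponding indicators. *)
Theorem exists_optimal_lattice : (BL mu L c < +oo)%E ->
  exists2 A : 'M[K]_n, A \in unitmx &
    [/\ forall j, c j != 0 -> row_free (M j),
        forall j, row_free (M j) ->
          nonneg_nonzero_sb (\1_(lattice (M j *m A)) : 'cV[K]_(d j) -> R) &
        BL mu L c = BL_at mu L c (fun j => \1_(lattice (M j *m A)))].
Proof.
move=> BLfin; have Mfree := BL_fin_row_free BLfin.
pose Phi := lattice_ratio mu M c.
have latP A j : A \in unitmx -> row_free (M j) ->
    compact_open (lattice (M j *m A)) /\ lattice (M j *m A) !=set0.
  move=> Au Mf; split; last exact: lattice_neq0.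
  by apply: row_free_compact_open; exact: row_free_mul_unit.
pose pre (A : 'M[K]_n) := common_preimage (fun j => lattice (M j *m A)).
have EP A : A \in unitmx -> forall j, c j != 0 ->
    compact_open (lattice (M j *m A)) /\ lattice (M j *m A) !=set0.
  by move=> Au j cj; apply: latP => //; exact: Mfree.
have Phi_pre A : A \in unitmx ->
    Phi A <= vol (pre A) / \prod_(j < m) vol (lattice (M j *m A)) `^ c j.
  move=> Au; rewrite /Phi lattice_ratioE; apply: ler_wpM2r.
    by rewrite invr_ge0 prodr_ge0// => j _; exact: powR_ge0.
  apply: (le_vol (mu_haar n)); first exact: lattice_compact_open.
    by apply: common_preimage_compact_open => j cj; case: (EP A Au j cj).
  by move=> _ [x x1 <-] j cj; exists x; rewrite ?mulmxA.
have Phi_BL A : A \in unitmx -> ((Phi A)%:E <= BL mu L c)%E.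
  move=> Au; apply: le_trans (BL_at_indic_le_BL (EP A Au)).
  by rewrite lee_fin; exact: Phi_pre.
have BLfn : BL mu L c \is a fin_num.
  rewrite ge0_fin_numE//; apply: le_trans (Phi_BL 1%:M (unitmx1 _ _)).
  by rewrite lee_fin ltW//; apply: lattice_ratio_gt0 => //; exact: unitmx1.
have PhiC A : A \in unitmx -> Phi A <= fine (BL mu L c).
  by move=> Au; rewrite -lee_fin fineK//; exact: Phi_BL.
have [A Au Amax] := exists_best_lattice mu_haar c0 Mfree PhiC.
exists A => //; split=> // [j Mf|]; first by have [] := latP A j Au Mf; exact: indic_nonneg_nonzero_sb.
rewrite (BL_at_indic (EP A Au)); apply/eqP; rewrite eq_le (BL_at_indic_le_BL (EP A Au)) andbT.
apply: ge_ereal_sup => _ [f fsb <-].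
have [M0 [N [[cM0 oM0] NP M0N BLle]]] := BL_at_le_modules fsb.
apply: le_trans BLle _; rewrite lee_fin.
have [B Bu M0E] := lattice_basis cM0 oM0.
apply: le_trans (Phi_pre A Au); apply: le_trans (Amax B Bu).
rewrite /Phi lattice_ratioE M0E; apply: ler_wpM2l; first exact: vol_ge0.
rewrite lef_pV2 ?posrE; last 2 first.
- apply: prodr_gt0 => j _; rewrite powR_gt0//.
  by apply: vol_gt0 => //; [exact: (proj1 (NP j))|exists 0; exact: (proj2 (NP j))].
- apply: prodr_gt0 => j _; have [->|cj] := eqVneq (c j) 0; first by rewrite powRr0.
  by have [cE E0] := EP B Bu j cj; rewrite powR_gt0// vol_gt0.
apply: ler_prod => j _; rewrite powR_ge0/=.
have [->|cj] := eqVneq (c j) 0; first by rewrite !powRr0.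
apply: ge0_ler_powR; rewrite ?nnegrE ?vol_ge0//.
apply: (le_vol (mu_haar (d j))).
- by case: (EP B Bu j cj).
- exact: (proj1 (NP j)).
move=> _ [x x1 <-]; rewrite -mulmxA; apply: M0N => //.
by rewrite M0E; exists x.
Qed.

End BrascampLiebData.

Theorem theorem1p6 (R : realType) (K : nonArchLocalFieldType R)
    (mu : forall k, {measure set (borel 'cV[mtop K]_k) -> \bar R})
    (mu_haar : forall k, normalized_haar (mu k))
    (n m : nat) (d : 'I_m -> nat)
    (L : forall j, {linear 'cV[K]_n -> 'cV[K]_(d j)})
    (c : 'I_m -> R) (c01 : forall j, 0 <= c j <= 1)
    (* only exponents [c j != 0] count: for [n = m = d j = 1], [L j] the
       identity and [c j = 0], [BL_at] and [BL] are always infinite *)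
    (kerL : \bigcap_(j in [set j | c j != 0]) (L j @^-1` [set 0]) = [set 0]) :
  ((BL mu L c < +oo)%E <->
     exists f : forall j, 'cV[K]_(d j) -> R,
       (forall j, nonneg_nonzero_sb (f j)) /\ BL mu L c = BL_at mu L c f)
  /\
  ((BL mu L c < +oo)%E ->
     exists2 A : 'M[K]_n, A \in unitmx &
       let f j : 'cV[K]_(d j) -> R :=
         \1_[set L j (A *m x) | x in unit_polydisc K n] in
       (forall j, c j != 0 \/ set_surj setT setT (L j) ->
          nonneg_nonzero_sb (f j)) /\
       BL mu L c = BL_at mu L c f).
Proof.
have c0 j : 0 <= c j by case/andP: (c01 j).
pose M j : 'M[K]_(d j, n) := \matrix_(i, l) L j (delta_mx l 0) i 0.
have LM j x : L j x = M j *m x.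
  rewrite {1}[x]matrix_sum_delta linear_sum; apply/colP => i; rewrite summxE mxE.
  by apply: eq_bigr => l _; rewrite big_ord1 linearZ !mxE mulrC.
have ker0 (x : 'cV[K]_n) : (forall j, c j != 0 -> M j *m x = 0) -> x = 0.
  move=> Mx; have : (\bigcap_(j in [set j | c j != 0]) (L j @^-1` [set 0])) x.
    by move=> j cj /=; rewrite LM; exact: Mx.
  by rewrite kerL.
have latE A j : [set L j (A *m x) | x in unit_polydisc K n] = lattice (M j *m A).
  by apply: eq_imagel => x _; rewrite LM mulmxA.
have free j : set_surj setT setT (L j) -> row_free (M j).
  move=> surj; have /choice[B BE] : forall l, exists x, L j x = delta_mx l 0.
    by move=> l; have [x _ xE] := surj (delta_mx l 0) I; exists x.
  apply/row_freeP; exists (\matrix_(i, l) B l i 0); apply/matrixP => i l.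
  have := congr1 (fun v : 'cV__ => v i 0) (BE l); rewrite LM !mxE eqxx andbT => e.
  by rewrite -[RHS]e; apply: eq_bigr => a _; rewrite !mxE.
have opt := exists_optimal_lattice mu_haar LM c0 ker0.
split.
  split=> [BLfin|[f [fsb ->]]]; last first.
    have [M0 [N [_ _ _ le]]] := BL_at_le_modules mu_haar LM c0 ker0 fsb.
    by apply: le_lt_trans le (ltry _).
  have [A Au [Mfree _ BLA]] := opt BLfin.
  have EP j : c j != 0 -> compact_open (lattice (M j *m A)) /\ lattice (M j *m A) !=set0.
    move=> cj; split; last exact: lattice_neq0.
    by apply: row_free_compact_open; apply: row_free_mul_unit (Mfree j cj) Au.
  have [f fsb fE] := exists_sb_indic mu_haar LM ker0 EP.
  by exists f; split=> //; rewrite fE.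
move=> BLfin; have [A Au [Mfree sbA BLA]] := opt BLfin.
exists A => //= ; split=> [j|].
  by rewrite latE => -[cj|/free]; [apply: sbA; exact: Mfree|exact: sbA].
by rewrite BLA; congr BL_at; apply/functional_extensionality_dep => j; rewrite latE.
Qed.
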